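(* Let $w$ be an admissible weight on $\{0\le s\le t\le b\}$ and let $k\in L^1(0,b)$ satisfy the weighted Sonine condition WSC1 with respect to $w$, with associated kernel $K\in L^1(0,b)$ and corresponding function $g$. Suppose $f\in W^{1,1}(0,b)$ and that there are constants $Q>0$ and $0<\sigma<1$ with $|g_2(s,t)|\le Qt^{-\sigma}$. Then the weighted first-kind Volterra integral equation $$\int_0^t w(s,t)k(t-s)u(s)\,ds=f(t),\qquad t\in(0,b],$$ admits a unique solution $u\in L^1(0,b)$.
   Context: Fix $b>0$. All functions are real-valued. For a function $q$ of two variables, $q_2$ denotes its partial derivative in the second variable. Equations in $t$ between integrable functions, and bounds on $w_2(s,t)$ and $g_2(s,t)$, are understood for almost every $t$. Admissible weight: a measurable $w$ on $\{0\le s\le t\le b\}$ such that for each $s$ the map $t\mapsto w(s,t)$ is absolutely continuous on $[s,b]$ (so $w(s,t)=w(s,s)+\int_s^tw_2(s,\theta)\,d\theta$), and (i) there are $0<\mu_*\le\mu^*$ with $\mu_*\le|w(t,t)|\le\mu^*$ for $t\in[0,b]$; (ii) there is $\bar w\in L^1(0,b)$ with $|w_2(s,t)|\le\bar w(t-s)$ for $0\le s\le t\le b$. WSC1: $k\in L^1(0,b)$ satisfies WSC1 with respect to $w$, with associated kernel $K\in L^1(0,b)$ and function $g$, if $$\int_0^t w(s,z+s)K(t-z)k(z)\,dz=g(s,t),\qquad s,t\ge0,\ 0\le s+t\le b,$$ (for each $s$, for a.e. $t\in(0,b-s)$), where $g$ is a measurable function on $\{s,t\ge 0,\ s+t\le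 b\}$, absolutely continuous in $t\in[0,b-s]$ for each $s$ (so $g(s,0)$ is the limit as $t\to0^+$), such that (a) there are $0<\nu_*\le\nu^*$ with $\nu_*\le|g(s,0)|\le\nu^*$ for $0\le s\le b$; (b) there is $\bar g\in L^1(0,b)$ with $|g_2(s,t)|\le\bar g(t)$ for $0\le s+t\le b$. *)

(* Defs.v *)
From HB Require Import structures.
From mathcomp Require Import all_boot all_order all_algebra.
From mathcomp Require Import all_classical all_reals all_analysis.
From mathcomp Require Import measurable_realfun.

Set Implicit Arguments.
Unset Strict Implicit.
Unset Printing Implicit Defensive.

Import Order.TTheory GRing.Theory Num.Theory.
Import numFieldNormedType.Exports.

Local Open Scope classical_set_scope.
Local Open Scope ring_scope.

(* Functions on subsets of the line or of the plane are total functions; only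
   their values on the relevant domain matter. Elements of L^1(a, b) are
   represented by Borel functions (every class has one), and are compared
   almost everywhere. *)

Definition L1 (R : realType) (a b : R) (f : R -> R) : Prop :=
  (@lebesgue_measure R).-integrable `]a, b[ (EFin \o f).

Definition ae_on (R : realType) (a b : R) (P : R -> Prop) : Prop :=
  {ae (@lebesgue_measure R), forall t : R, t \in `]a, b[ -> P t}.

Definition abs_continuous (R : realType) (a b : R) (f : R -> R) : Prop :=
  forall e : R, 0 < e -> exists2 d : R, 0 < d &
    forall (n : nat) (x y : 'I_n -> R),
      (forall i, [/\ a <= x i, x i <= y i & y i <= b]) ->
      trivIset setT (fun i => `]x i, y i[%classic) ->
      \sum_i (y i - x i) < d ->
      \sum_i `|f (y i) - f (x i)| < e.

(* Lebesgue (not only Borel) measurability on D: preimages belong to the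
   completion of the Borel sets of the plane. The library's integral, being the
   supremum of the integrals of simple Borel minorants (for each of the positive
   and negative parts), still is the Lebesgue integral for functions that are
   almost everywhere equal to a Borel function. *)
Definition measurable2_on (R : realType) (D : set (R * R)) (q : R -> R -> R) :
    Prop :=
  forall B : set R, measurable B ->
    completed_algebra_gen (@lebesgue_measure R \x @lebesgue_measure R)%E
      (D `&` [set p | B (q p.1 p.2)]).

Definition d2 (R : realType) (q : R -> R -> R) (s t : R) : R := derive1 (q s) t.

Definition admissible_weight (R : realType) (b : R) (w : R -> R -> R) : Prop :=
  [/\ measurable2_on [set p | 0 <= p.1 /\ p.1 <= p.2 /\ p.2 <= b] w,
      forall s : R, s \in `[0, b] -> abs_continuous s b (w s),
      exists mu1 mu2 : R, [/\ 0 < mu1, mu1 <= mu2 &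
        forall t : R, t \in `[0, b] -> mu1 <= `|w t t| <= mu2] &
      exists2 wbar : R -> R, L1 0 b wbar &
        forall s : R, s \in `[0, b] ->
          ae_on s b (fun t =>
            derivable (w s) t 1 /\ `|d2 w s t| <= wbar (t - s))].

Definition WSC1 (R : realType) (b : R) (w : R -> R -> R) (k K : R -> R)
    (g : R -> R -> R) : Prop :=
  [/\ L1 0 b k /\ L1 0 b K,
      forall s : R, s \in `[0, b] ->
        ae_on 0 (b - s) (fun t =>
          \int[@lebesgue_measure R]_(z in `]0, t[)
            (w s (z + s) * K (t - z) * k z) = g s t),
      measurable2_on [set p | 0 <= p.1 /\ 0 <= p.2 /\ p.1 + p.2 <= b] g /\
        (forall s : R, s \in `[0, b] -> abs_continuous 0 (b - s) (g s)),
      exists nu1 nu2 : R, [/\ 0 < nu1, nu1 <= nu2 &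
        forall s : R, s \in `[0, b] -> nu1 <= `|g s 0| <= nu2] &
      exists2 gbar : R -> R, L1 0 b gbar &
        forall s : R, s \in `[0, b] ->
          ae_on 0 (b - s) (fun t =>
            derivable (g s) t 1 /\ `|d2 g s t| <= gbar t)].

Definition test_function (R : realType) (a b : R) (phi : R -> R) : Prop :=
  [/\ forall (n : nat) (x : R), derivable (derive1n n phi) x 1,
      compact (closure [set x | phi x != 0]) &
      closure [set x | phi x != 0] `<=` `]a, b[].

(* The Sobolev space W^{1,1}(a, b), through weak derivatives. *)
Definition W11 (R : realType) (a b : R) (f : R -> R) : Prop :=
  L1 a b f /\
  exists2 h : R -> R, L1 a b h &
    forall phi : R -> R, test_function a b phi ->
      \int[@lebesgue_measure R]_(x in `]a, b[) (f x * derive1 phi x) =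
      - \int[@lebesgue_measure R]_(x in `]a, b[) (h x * phi x).

Definition volterra_solution (R : realType) (b : R) (w : R -> R -> R)
    (k f u : R -> R) : Prop :=
  L1 0 b u /\
  ae_on 0 b (fun t =>
    \int[@lebesgue_measure R]_(s in `]0, t[) (w s t * k (t - s) * u s) = f t).

(* Main.v *)
Require Import Defs.
From HB Require Import structures.
From mathcomp Require Import all_boot all_order all_algebra.
From mathcomp Require Import all_classical all_reals all_analysis.
From mathcomp Require Import measurable_realfun.
From mathcomp Require Import ring lra.

Set Implicit Arguments.
Unset Strict Implicit.
Unset Printing Implicit Defensive.

Import Order.TTheory GRing.Theory Num.Theory.
Import numFieldNormedType.Exports.

Local Open Scope classical_set_scope.
Local Open Scope ring_scope.

(* Convolving the equation with K and exchanging the integrals turns it, by the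
   Sonine condition, into the integral over s < t of g(s,t-s) u(s); since
   g(s,.) is absolutely continuous, this is the primitive of
   g(t,0) u(t) + (integral over s < t of g_2(s,t-s) u(s)). With f = c + (primitive of h),
   every solution thus satisfies the second-kind Volterra equation with right-hand
   side cK + K*h, whose kernel is dominated by a function of t-s. In
   L^1 with the weight exp(-n t), n large, that equation is a contraction, hence
   uniquely solvable. Conversely, for its solution u the residual r of the
   first-kind equation satisfies K*r = 0; convolving with w(0,.)k gives
   g(0,.)*r = 0, whose derivative is again a homogeneous second-kind equation, so
   r = 0. *)

(** * Volterra operators *)

(** Two obstacles shape the development. The converse step needs the convolution with [K] to be
    injective. The Sonine identity at [s] holds only for [t < b - s], so [s = 0] is the only slice
    covering all of []0, b[]; there it says that [K] convolved with w(0,.)k is g(0,.). These are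
    ordinary convolutions, which commute, so w(0,.)k undoes [K] up to the primitive of a second-kind
    operator. The other obstacle is measurability: [w] and [g] are measurable only for the completed
    plane, while Fubini acts on Borel functions. Continuity of the sections yields Borel versions
    off a null set of [s], and [0] has to stay outside that set because of the slice just mentioned.
    Domination of the kernels is arranged everywhere, by truncation, so that the operators act on
    L^1 of the whole line; functions on []0, b[] are extended by zero. Almost everywhere
    differentiability of the sections is part of the data, so absolute continuity only has to supply
    the fundamental theorem of calculus. The representation of [f] is extracted from the weak
    derivative by testing against explicit smooth bumps. *)

Section translation.
Context {R : realType}.
Notation mu := (@lebesgue_measure R).

Lemma lebesgue_measure_translation (a : R) (A : set R) : measurable A ->
  pushforward mu ((fun x => x + a) : measurableTypeR R -> measurableTypeR R) A = mu A.
Proof.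
have ms : measurable_fun setT ((fun x => x + a) : measurableTypeR R -> measurableTypeR R).
  by apply: measurable_funD.
move=> mA; apply/esym.
pose f : {mfun measurableTypeR R >-> measurableTypeR R} := HB.pack (fun x => x + a) (isMeasurableFun.Build _ _ _ _ _ ms).
apply: (@lebesgue_measure_unique R (pushforward mu f)) => //= _ [[x y]] _ <-.
rewrite /pushforward/= [X in _ = mu X](_ : _ = `](x - a), (y - a)]%classic).
  rewrite !lebesgue_measure_itv/= !lte_fin ltrD2r.
  by case: ifP => // _; rewrite -!EFinD; congr EFin; ring.
by apply/seteqP; split => z /=; rewrite !in_itv/= ltrBlDr lerBrDr.
Qed.

Lemma ge0_integral_translation (a : R) (f : R -> \bar R) :
  measurable_fun setT f -> (forall x, 0 <= f x)%E ->
  (\int[mu]_x f (x + a)%R = \int[mu]_x f x)%E.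
Proof.
move=> mf f0.
have ms : measurable_fun setT ((fun x => x + a) : measurableTypeR R -> measurableTypeR R).
  by apply: measurable_funD.
pose h : {mfun measurableTypeR R >-> measurableTypeR R} := HB.pack (fun x => x + a) (isMeasurableFun.Build _ _ _ _ _ ms).
have := @ge0_integral_pushforward _ _ _ _ R _ ms mu setT f measurableT mf (fun x _ => f0 x).
rewrite preimage_setT => <-.
by apply: eq_measure_integral => A mA _; exact: lebesgue_measure_translation.
Qed.
End translation.

Section vop.
Context {R : realType}.
Notation mu := (@lebesgue_measure R).
Implicit Types (f u v : R -> R) (A : R -> R -> R).

Lemma integral_translation (a : R) (f : R -> \bar R) :
  measurable_fun setT f -> (\int[mu]_x f (x + a)%R = \int[mu]_x f x)%E.
Proof.
move=> mf; rewrite integralE [RHS]integralE.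
have tp (h : R -> \bar R) : measurable_fun setT h -> (forall x, 0 <= h x)%E ->
    (\int[mu]_x h (x + a)%R = \int[mu]_x h x)%E := @ge0_integral_translation R a h.
rewrite -(tp _ (measurable_funepos mf))// -(tp _ (measurable_funeneg mf))//.
by congr (_ - _)%E; apply: eq_integral => x _; rewrite ?(funepos_comp f (fun x => x + a)) ?(funeneg_comp f (fun x => x + a)).
Qed.

Lemma aeW (P Q : R -> Prop) : {ae mu, forall x, P x} ->
  (forall x, P x -> Q x) -> {ae mu, forall x, Q x}.
Proof. by move=> hP PQ; apply: (@filterS _ _ (ae_filter_ringOfSetsType mu)) hP. Qed.

Lemma aeW2 (P Q S : R -> Prop) : {ae mu, forall x, P x} -> {ae mu, forall x, Q x} ->
  (forall x, P x -> Q x -> S x) -> {ae mu, forall x, S x}.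
Proof. by move=> hP hQ PQ; apply: (@filterS2 _ _ (ae_filter_ringOfSetsType mu)) hP hQ. Qed.

Lemma aeW3 (P Q S T : R -> Prop) : {ae mu, forall x, P x} -> {ae mu, forall x, Q x} ->
  {ae mu, forall x, S x} ->
  (forall x, P x -> Q x -> S x -> T x) -> {ae mu, forall x, T x}.
Proof. by move=> hP hQ hS PQ; apply: (@filterS3 _ _ (ae_filter_ringOfSetsType mu)) hP hQ hS. Qed.

Lemma eq_int (f g : R -> \bar R) : f =1 g -> (\int[mu]_x f x = \int[mu]_x g x)%E.
Proof. by move=> fg; apply: eq_integral => x _. Qed.

Lemma ae_eq_int (f g : R -> \bar R) : measurable_fun setT f -> measurable_fun setT g ->
  {ae mu, forall x, f x = g x} -> (\int[mu]_x f x = \int[mu]_x g x)%E.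
Proof.
by move=> mf mg fg; apply: ae_eq_integral => //; apply: aeW fg _ => x fgx _.
Qed.

Lemma ge0_le_int (f g : R -> \bar R) : measurable_fun setT f -> measurable_fun setT g ->
  (forall x, 0 <= f x)%E -> (forall x, f x <= g x)%E ->
  (\int[mu]_x f x <= \int[mu]_x g x)%E.
Proof. by move=> mf mg f0 fg; apply: ge0_le_integral. Qed.

Lemma L1_le (f g : R -> R) : measurable_fun setT f -> (forall x, `|f x| <= g x) ->
  mu.-integrable setT (EFin \o g) -> mu.-integrable setT (EFin \o f).
Proof.
move=> mf fg; apply: le_integrable => //; first exact/measurable_EFinP.
by move=> x _; rewrite /= lee_fin (le_trans (fg x))// ler_norm.
Qed.

Lemma measurable_pair1 d (T : measurableType d) (f : R * R -> T) (x : R) :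
  measurable_fun setT f -> measurable_fun setT (fun y => f (x, y)).
Proof. by move=> mf; apply: measurableT_comp. Qed.

Lemma measurable_pair2 d (T : measurableType d) (f : R * R -> T) (y : R) :
  measurable_fun setT f -> measurable_fun setT (fun x => f (x, y)).
Proof. by move=> mf; apply: measurableT_comp. Qed.

Lemma measurable_swap d (T : measurableType d) (f : R * R -> T) :
  measurable_fun setT f -> measurable_fun setT (fun p : R * R => f (p.2, p.1)).
Proof. by move=> mf; apply: (measurableT_comp mf); apply/measurable_fun_pair. Qed.

Lemma measurable_integral2 d (T : measurableType d) (f : T * R -> \bar R) :
  measurable_fun setT f -> measurable_fun setT (fun x => \int[mu]_y f (x, y))%E.
Proof.
move=> mf; under eq_fun do rewrite integralE.
under eq_fun do under eq_integral do rewrite funepos_comp/=.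
under eq_fun do under [X in (_ - X)%E]eq_integral do rewrite funeneg_comp/=.
apply: emeasurable_funB.
  by apply: (@measurable_fun_fubini_tonelli_F _ _ _ _ _ mu (f^\+)%E) => //; exact: measurable_funepos.
by apply: (@measurable_fun_fubini_tonelli_F _ _ _ _ _ mu (f^\-)%E) => //; exact: measurable_funeneg.
Qed.

Lemma measurable_integral1 (f : R * R -> \bar R) :
  measurable_fun setT f -> measurable_fun setT (fun x => \int[mu]_y f (x, y))%E.
Proof. exact: measurable_integral2. Qed.

(** Tonelli, then the translation t = x - s in the inner integral. This change of variables lets a
    bound that depends on t alone factor out of the double integral. *)
Lemma ge0_integral_shear (f : R * R -> \bar R) :
  measurable_fun setT f -> (forall p, 0 <= f p)%E ->
  (\int[mu]_x \int[mu]_s f (s, x - s)%R = \int[mu]_s \int[mu]_t f (s, t))%E.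
Proof.
move=> mf f0.
have mF : measurable_fun setT (fun p : R * R => f (p.1, p.2 - p.1)).
  apply: (measurableT_comp mf); apply/measurable_fun_pair => //=.
  exact: measurable_funB.
rewrite -(@fubini_tonelli _ _ _ _ _ mu mu (fun p : R * R => f (p.1, p.2 - p.1)))//=.
apply: eq_integral => s _.
rewrite -(ge0_integral_translation (- s) (f := fun t => f (s, t)))//.
exact: measurableT_comp.
Qed.

(* Kernels are written in the relative position [t = x - s], so that domination
   by an integrable [gam] makes [vop A] a bounded operator of L^1. *)
Definition rel_kernel (gam : R -> R) A :=
  [/\ measurable_fun setT (fun p : R * R => A p.1 p.2),
      mu.-integrable setT (EFin \o gam) & forall s t, `|A s t| <= gam t].

Definition vop A u x := \int[mu]_s (A s (x - s) * u s).

Lemma measurable_vop_integrand A u :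
  measurable_fun setT (fun p : R * R => A p.1 p.2) -> measurable_fun setT u ->
  measurable_fun setT (fun p : R * R => A p.2 (p.1 - p.2) * u p.2).
Proof.
move=> mA mu_; apply: measurable_funM; last exact: measurableT_comp.
apply: (measurableT_comp mA (g := fun p : R * R => (p.2, p.1 - p.2))).
by apply/measurable_fun_pair => //=; exact: measurable_funB.
Qed.

Lemma L1_measurable f : mu.-integrable setT (EFin \o f) -> measurable_fun setT f.
Proof. by move=> /integrableP[/measurable_EFinP]. Qed.

Lemma rel_kernel_ge0 gam A t : rel_kernel gam A -> 0 <= gam t.
Proof. by move=> [_ _ /(_ 0 t)]; exact: le_trans. Qed.

(** Young's inequality: after the shear, the domination by [gam] splits the double integral into a
    product. The absolute value stands inside both integrals, so the bound also gives the
    integrability on the plane that Fubini requires. *)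
Lemma vop_norm_le gam A u : rel_kernel gam A -> measurable_fun setT u ->
  (\int[mu]_x \int[mu]_s `|A s (x - s) * u s|%:E
   <= (\int[mu]_t (gam t)%:E) * \int[mu]_s `|u s|%:E)%E.
Proof.
move=> kA mu_; have g0 t := rel_kernel_ge0 t kA; case: kA => mA /integrableP[/measurable_EFinP mgam _] Ale.
rewrite (@ge0_integral_shear (fun p => `|A p.1 p.2 * u p.1|%:E)); last by [].
  rewrite -ge0_integralZl//; last 2 first.
  - by apply/measurable_EFinP; apply: measurableT_comp.
  - by apply: integral_ge0 => x _; rewrite lee_fin.
  apply: ge0_le_integral => //.
  - by move=> x _; apply: integral_ge0 => t _; rewrite lee_fin.
  - apply: (measurable_integral1 (f := fun p : R * R => (`|A p.1 p.2 * u p.1|)%:E)).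
    apply/measurable_EFinP/measurableT_comp => //.
    apply: measurable_funM => //; exact: measurableT_comp.
  - apply: emeasurable_funM => //; exact/measurable_EFinP/measurableT_comp.
  move=> s _; rewrite /= -ge0_integralZr//; last 2 first.
  - by apply/measurable_EFinP.
  - by move=> x _; rewrite lee_fin.
  apply: ge0_le_integral => //=.
  - apply/measurable_EFinP/measurableT_comp => //.
    apply: measurable_funM => //.
    have mAs : measurable_fun setT (A s) := measurable_pair1 s mA.
    exact: mAs.
  - by apply: emeasurable_funM => //; exact/measurable_EFinP.
  - by move=> t _; rewrite -EFinM lee_fin normrM ler_wpM2r.
apply/measurable_EFinP/measurableT_comp => //.
by apply: measurable_funM => //; exact: measurableT_comp.
Qed.

Lemma integrable_norm_lty u : mu.-integrable setT (EFin \o u) ->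
  (\int[mu]_s `|u s|%:E < +oo)%E.
Proof. by move=> /integrableP[_]. Qed.

Lemma integrable_vop_integrand gam A u : rel_kernel gam A ->
  mu.-integrable setT (EFin \o u) ->
  (mu \x mu)%E.-integrable [set: R * R] (fun p : R * R => (A p.2 (p.1 - p.2) * u p.2)%:E).
Proof.
move=> kA iu; have mu_ := L1_measurable iu; apply/integrable12ltyP.
  by apply/measurable_EFinP; apply: (measurable_vop_integrand (A := A) (u := u)) => //; case: kA.
apply: (le_lt_trans (vop_norm_le kA mu_)).
apply: lte_mul_pinfty.
- by apply: integral_ge0 => x _; rewrite lee_fin (rel_kernel_ge0 _ kA).
- by apply: integrable_fin_num => //; case: kA.
- exact: integrable_norm_lty.
Qed.

Lemma ae_integrable_vop gam A u : rel_kernel gam A ->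
  mu.-integrable setT (EFin \o u) ->
  {ae mu, forall x, mu.-integrable setT (fun s => (A s (x - s) * u s)%:E)}.
Proof.
move=> kA iu; exact: (ae_integrable1 (integrable_vop_integrand kA iu)).
Qed.

Lemma le_abs_fine (x : \bar R) : (`|(fine x)%:E| <= `|x|)%E.
Proof. by case: x => //=; rewrite ?normr0 ?leey. Qed.

Lemma vop_integrable gam A u : rel_kernel gam A ->
  mu.-integrable setT (EFin \o u) -> mu.-integrable setT (EFin \o vop A u).
Proof.
move=> kA iu; have iG := integrable_fubini_F (integrable_vop_integrand kA iu).
apply: le_integrable iG => //.
  apply/measurable_EFinP; apply: measurableT_comp => //.
  exact: (measurable_fubini_F (integrable_vop_integrand kA iu)).
by move=> x _ /=; exact: le_abs_fine.
Qed.

Lemma vop_L1_le gam A u : rel_kernel gam A -> mu.-integrable setT (EFin \o u) ->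
  (\int[mu]_x `|vop A u x|%:E
   <= (\int[mu]_t (gam t)%:E) * \int[mu]_s `|u s|%:E)%E.
Proof.
move=> kA iu; have mu_ := L1_measurable iu.
apply: le_trans (vop_norm_le kA mu_).
have mAu : measurable_fun setT (fun p : R * R => A p.2 (p.1 - p.2) * u p.2).
  by apply: measurable_vop_integrand => //; case: kA.
apply: ge0_le_integral => //.
- by apply/measurable_EFinP/measurableT_comp => //; exact: L1_measurable (vop_integrable kA iu).
- apply: (measurable_integral1 (f := fun p : R * R => (`|A p.2 (p.1 - p.2) * u p.2|)%:E)).
  exact/measurable_EFinP/measurableT_comp.
move=> x _; have : measurable_fun setT (fun s => (A s (x - s) * u s)%:E).
  by apply/measurable_EFinP; exact: (measurable_pair1 x mAu).
move=> /(le_abse_integral mu measurableT); apply: le_trans.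
exact: le_abs_fine.
Qed.

Lemma vopB gam A u v : rel_kernel gam A -> mu.-integrable setT (EFin \o u) ->
  mu.-integrable setT (EFin \o v) ->
  {ae mu, forall x, vop A (u \- v) x = vop A u x - vop A v x}.
Proof.
move=> kA iu iv; apply: (aeW2 (ae_integrable_vop kA iu) (ae_integrable_vop kA iv)) => x iu' iv'; rewrite /vop -RintegralB//.
by apply: eq_Rintegral => s _; rewrite mulrBr.
Qed.

(** Values on a null set do not enter the integral over [s], hence equality at every point and not
    only almost everywhere. *)
Lemma eq_ae_vop gam A u v : rel_kernel gam A -> mu.-integrable setT (EFin \o u) ->
  mu.-integrable setT (EFin \o v) ->
  {ae mu, forall x, u x = v x} -> vop A u = vop A v.
Proof.
move=> kA iu iv uv; apply/funext => x; congr fine.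
have mA (w : R -> R) : mu.-integrable setT (EFin \o w) -> measurable_fun setT (fun s => (A s (x - s) * w s)%:E).
  move=> iw; apply/measurable_EFinP.
  have := measurable_vop_integrand (let: And3 a _ _ := kA in a) (L1_measurable iw).
  move=> h; exact: (measurable_pair1 x h).
apply: ae_eq_integral => //; [exact: mA|exact: mA|].
by apply: aeW uv _ => s -> _.
Qed.

Lemma lebesgue_measure_reflection (A : set R) : measurable A ->
  pushforward mu ((fun x => - x) : measurableTypeR R -> measurableTypeR R) A = mu A.
Proof. exact: lebesgue_measureN. Qed.

Lemma integral_reflection (a : R) (f : R -> \bar R) :
  measurable_fun setT f -> (\int[mu]_x f (a - x)%R = \int[mu]_x f x)%E.
Proof.
move=> mf; rewrite -(integral_translation a mf).
have mN : measurable_fun setT ((fun x => - x) : measurableTypeR R -> measurableTypeR R).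
  by have := @measurable_funN _ _ R setT id (@measurable_id _ _ setT).
have mfa : measurable_fun setT (fun x : R => f (x + a)).
  by apply: (measurableT_comp mf); exact: measurable_funD.
have ge0 (h : R -> \bar R) : measurable_fun setT h -> (forall x, 0 <= h x)%E ->
    (\int[mu]_x h (- x)%R = \int[mu]_x h x)%E.
  move=> mh h0.
  have := @ge0_integral_pushforward _ _ _ _ R _ mN mu setT h measurableT mh (fun x _ => h0 x).
  rewrite preimage_setT => <-.
  by apply: eq_measure_integral => A mA _; exact: lebesgue_measure_reflection.
pose F x := f (x + a).
rewrite (@eq_int _ (fun x => F (- x))); last by move=> x; rewrite /F addrC.
rewrite -/F integralE [RHS]integralE.
rewrite -(ge0 _ (measurable_funepos mfa))// -(ge0 _ (measurable_funeneg mfa))//.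
by congr (_ - _)%E; apply: eq_int => x; rewrite ?(funepos_comp F (fun x => - x)) ?(funeneg_comp F (fun x => - x)).
Qed.

End vop.

(** * Composition of Volterra operators and kernels that are primitives *)

Section comp.
Context {R : realType}.
Notation mu := (@lebesgue_measure R).
Implicit Types (f u v : R -> R) (A : R -> R -> R).

Lemma L1_restrict (D : set R) f : measurable D ->
  mu.-integrable D (EFin \o f) -> mu.-integrable setT (EFin \o (f \_ D)).
Proof. by move=> mD /integrable_mkcond -/(_ mD); rewrite restrict_EFin. Qed.

Lemma integrable_translation (a : R) f : mu.-integrable setT (EFin \o f) ->
  mu.-integrable setT (fun x => (f (x + a))%:E).
Proof.
move=> /integrableP[mf fi]; apply/integrableP; split.
  apply/measurable_EFinP; move/measurable_EFinP: mf => mf.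
  by apply: (measurableT_comp (f := f) (g := fun x : R => x + a)) => //; exact: measurable_funD.
by rewrite (@integral_translation R a (fun x => `|(f x)%:E|)%E)//; exact: measurableT_comp.
Qed.

(** The integral of |f| over the plane vanishes, and the shear preserves it. This carries identities
    known for almost every relative position t over to almost every point s of the line s + t =
    x. *)
Lemma ae_shear (f : R * R -> R) : measurable_fun setT f ->
  {ae mu, forall s, {ae mu, forall t, f (s, t) = 0}} ->
  {ae mu, forall x, {ae mu, forall s, f (s, x - s) = 0}}.
Proof.
move=> mf f0.
have mf' : measurable_fun setT (fun p => `|f p|%:E).
  by apply/measurable_EFinP/measurableT_comp.
have mF : measurable_fun setT (fun p : R * R => f (p.2, p.1 - p.2)).
  apply: (measurableT_comp mf); apply/measurable_fun_pair => //=.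
  exact: measurable_funB.
have mF' : measurable_fun setT (fun p : R * R => `|f (p.2, p.1 - p.2)|%:E).
  by apply/measurable_EFinP/measurableT_comp.
have e0 : (\int[mu]_x \int[mu]_s `|f (s, x - s)%R|%:E = 0)%E.
  rewrite (@ge0_integral_shear R (fun p => `|f p|%:E))//.
  rewrite (@ae_eq_integral _ _ _ mu setT (cst 0%E))//.
  - by rewrite integral0.
  - exact: (measurable_integral1 mf').
  - apply: aeW f0 _ => s hs _ /=.
    rewrite (@ae_eq_integral _ _ _ mu setT (cst 0%E))//; first by rewrite integral0.
      exact: (measurable_pair1 s mf').
    by apply: aeW hs _ => t -> _ /=; rewrite normr0.
have mI := measurable_integral1 mF'; rewrite /= in mI.
have := (ae_eq_integral_abs mu measurableT mI).1.
have -> : (\int[mu]_x `|\int[mu]_y `|f (y, x - y)%R|%:E| = 0)%E.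
  rewrite -[RHS]e0; apply: eq_integral => x _; rewrite gee0_abs//.
  by apply: integral_ge0 => s _; rewrite lee_fin.
move=> /(_ erefl) h; apply: aeW h _ => x /(_ I) /= hx.
have mx := measurable_pair1 x mF; rewrite /= in mx.
have mx' : measurable_fun setT (fun s : R => (f (s, x - s))%:E) by exact/measurable_EFinP.
have := (ae_eq_integral_abs mu measurableT mx').1 hx.
by move=> h'; apply: aeW h' _ => s /(_ I) [].
Qed.

(** Fubini for fixed x, followed by the translation z = y - s: in relative position, the kernel of
    the composite is the convolution of [K] with the section of [A] at [s]. *)
Lemma vop_assoc gam A (K u : R -> R) : rel_kernel gam A ->
  mu.-integrable setT (EFin \o K) -> mu.-integrable setT (EFin \o u) ->
  {ae mu, forall x, vop (fun _ => K) (vop A u) x =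
    vop (fun s t => \int[mu]_z (K (t - z) * A s z)) u x}.
Proof.
move=> kA iK iu; have mK := L1_measurable iK; have mu_ := L1_measurable iu.
have mA : measurable_fun setT (fun p : R * R => A p.1 p.2) by case: kA.
have mAu := measurable_vop_integrand mA mu_.
pose a (y : R) : \bar R := (\int[mu]_s `|A s (y - s)%R * u s|%:E)%E.
have ma : measurable_fun setT a.
  apply: (@measurable_integral1 R (fun p => `|A p.2 (p.1 - p.2) * u p.2|%:E)).
  exact/measurable_EFinP/measurableT_comp.
have a0 y : (0 <= a y)%E by apply: integral_ge0 => s _; rewrite lee_fin.
have aoo : (\int[mu]_y a y < +oo)%E.
  apply: (le_lt_trans (vop_norm_le kA mu_)); apply: lte_mul_pinfty.
  - by apply: integral_ge0 => x _; rewrite lee_fin (rel_kernel_ge0 _ kA).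
  - by apply: integrable_fin_num => //; case: kA.
  - exact: integrable_norm_lty.
have mKa : measurable_fun setT (fun p : R * R => `|K p.2|%:E * a p.1)%E.
  apply: emeasurable_funM.
    by apply/measurable_EFinP/measurableT_comp => //; exact: measurableT_comp.
  exact: measurableT_comp.
(* [I] is |K| convolved with [a]. By the shear it is integrable, hence finite for almost every x,
   and finiteness of [I x] is exactly the integrability that Fubini needs at that x. *)
pose I (x : R) : \bar R := (\int[mu]_y (`|K (x - y)%R|%:E * a y))%E.
have mI : measurable_fun setT I.
  apply: (@measurable_integral1 R (fun p => `|K (p.1 - p.2)|%:E * a p.2)%E).
  apply: emeasurable_funM.
    apply/measurable_EFinP/measurableT_comp => //; apply: (measurableT_comp mK (g := fun p : R * R => p.1 - p.2)).
    exact: measurable_funB.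
  exact: measurableT_comp.
have I0 x : (0 <= I x)%E.
  by apply: integral_ge0 => y _; rewrite mule_ge0// lee_fin.
have iI : mu.-integrable setT I.
  apply/integrableP; split => //.
  under eq_integral do rewrite gee0_abs//.
  rewrite (@ge0_integral_shear R (fun p => `|K p.2|%:E * a p.1)%E); last 2 first.
  - exact: mKa.
  - by move=> p; rewrite mule_ge0// lee_fin.
  rewrite (@eq_int _ _ (fun y => (\int[mu]_t `|K t|%:E) * a y)%E); last first.
    move=> y; rewrite /= ge0_integralZr//.
    by apply/measurable_EFinP/measurableT_comp.
  rewrite ge0_integralZl//; last by apply: integral_ge0 => t _; rewrite lee_fin.
  apply: lte_mul_pinfty => //.
    by apply: integral_ge0 => x _; rewrite lee_fin.
  apply: integrable_fin_num => //.
  by have := integrable_abse iK.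
apply: (aeW (integrable_ae measurableT iI)) => x /(_ Logic.I) Ix.
have mF : measurable_fun setT (fun p : R * R => (K (x - p.1) * (A p.2 (p.1 - p.2) * u p.2))%:E).
  apply/measurable_EFinP/measurable_funM => //.
  apply: (measurableT_comp mK (g := fun p : R * R => x - p.1)).
  exact: measurable_funB.
have iF : (mu \x mu)%E.-integrable [set: R * R]
    (fun p : R * R => (K (x - p.1) * (A p.2 (p.1 - p.2) * u p.2))%:E).
  apply/integrable12ltyP; first exact: mF.
  rewrite /=.
  rewrite (@eq_int _ _ (fun y => `|K (x - y)|%:E * a y)%E); last first.
    move=> y; under eq_integral do rewrite normrM EFinM.
    rewrite ge0_integralZl//.
    have h := measurable_pair1 y mAu; rewrite /= in h.
    by apply/measurable_EFinP/measurableT_comp.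
  by rewrite -/(I x) ltey_eq Ix.
have mFxy := measurable_integral1 mF; rewrite /= in mFxy.
rewrite /vop /Rintegral.
transitivity (fine (\int[mu]_y \int[mu]_s (K (x - y)%R * (A s (y - s)%R * u s))%:E)).
  congr fine; apply: ae_eq_integral => //.
    apply/measurable_EFinP; apply: measurable_funM.
      by apply: (measurableT_comp mK (g := fun p : R => x - p)); exact: measurable_funB.
    exact: L1_measurable (vop_integrable kA iu).
  apply: (aeW (ae_integrable_vop kA iu)) => y iy _ /=.
  by rewrite EFinM fineK ?integrable_fin_num// -integralZl.
congr fine; rewrite (Fubini iF)/=.
have mG : measurable_fun setT (fun s => (\int[mu]_y (K (x - y)%R * (A s (y - s)%R * u s))%:E)%E).
  apply: (@measurable_integral1 R (fun p => (K (x - p.2) * (A p.1 (p.2 - p.1) * u p.1))%:E)).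
  exact: (measurable_swap mF).

have mKA : measurable_fun setT (fun q : R * R => K (x - q.1 - q.2) * A q.1 q.2).
  apply: measurable_funM => //.
  apply: (measurableT_comp mK (g := fun p : R * R => x - p.1 - p.2)).
  by apply: measurable_funB => //; exact: measurable_funB.
apply: ae_eq_integral => //.
  apply/measurable_EFinP/measurable_funM => //; apply: measurableT_comp => //.
  apply: (@measurable_integral1 R (fun q : R * R => (K (x - q.1 - q.2) * A q.1 q.2)%:E)).
  exact/measurable_EFinP.
apply: (aeW (ae_integrable2 iF)) => s iFs _ /=.
(* If u(s) = 0, the integral defining the composed kernel may diverge, but both sides vanish.
   Otherwise division by u(s) yields its integrability. *)
have [us0|us0] := eqVneq (u s) 0.
  rewrite us0 mulr0 (@eq_int _ _ (fun=> 0%E)) ?integral0// => y.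
  by rewrite !mulr0.
have iKA : mu.-integrable setT (fun y => (K (x - y) * A s (y - s))%:E).
  have := integrableZr measurableT (u s)^-1 iFs.
  apply: eq_integrable => // y _ /=.
  by rewrite -EFinM !mulrA mulfK.
rewrite (@eq_int _ _ (fun y => (K (x - y) * A s (y - s))%:E * (u s)%:E)%E); last first.
  by move=> y; rewrite -EFinM mulrA.
rewrite integralZr// EFinM; congr (_ * _)%E.
rewrite -(fineK (integrable_fin_num measurableT iKA)); congr (fine _)%:E.
rewrite -(@integral_translation R (- s) (fun z => (K (x - s - z) * A s z)%:E)).
  by apply: eq_integral => y _; congr (K _ * _)%:E; ring.
by apply/measurable_EFinP; exact: (measurable_pair1 s mKA).
Qed.

(** Fubini on the half-plane y <= x. This is the integrated form of differentiating, in x, the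
    integral of a kernel that jumps from 0 to g0(s) at relative position 0 and has derivative [A s]
    beyond it; the factor [(s <= x)] is that jump. *)
Lemma vop_primitive gam A (g0 u : R -> R) (C : R) (x : R) :
  rel_kernel gam A -> mu.-integrable setT (EFin \o u) ->
  measurable_fun setT g0 -> (forall s, `|g0 s| <= C) ->
  \int[mu]_s (((s <= x)%R%:R * g0 s + \int[mu]_(t in `]-oo, x - s]) A s t) * u s) =
  \int[mu]_(y in `]-oo, x]) (g0 y * u y + vop A u y).
Proof.
move=> kA iu mg0 g0C; have mu_ := L1_measurable iu.
have mA : measurable_fun setT (fun p : R * R => A p.1 p.2) by case: kA.
have ig0u : mu.-integrable setT (EFin \o (fun y => g0 y * u y)).
  apply: (@L1_le _ _ (fun y => C * `|u y|)).
  - exact: measurable_funM.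
  - by move=> y; rewrite normrM ler_wpM2r.
  - by have := integrableZl measurableT C (integrable_abse iu).
have iA := vop_integrable kA iu.
rewrite RintegralD//; [|exact: integrableS ig0u|exact: integrableS iA].
pose F (p : R * R) : R := \1_`]-oo, x] p.2 * (A p.1 (p.2 - p.1) * u p.1).
have mAu' : measurable_fun setT (fun p : R * R => A p.1 (p.2 - p.1) * u p.1).
  exact: (measurable_swap (measurable_vop_integrand mA mu_)).
have mF : measurable_fun setT F.
  apply: measurable_funM => //.
  exact: (measurableT_comp (measurable_indic _)).
have iF : (mu \x mu)%E.-integrable setT (fun p => (F p)%:E).
  apply/integrable21ltyP; first exact/measurable_EFinP.
  apply: (@le_lt_trans _ _ ((\int[mu]_t (gam t)%:E) * \int[mu]_s `|u s|%:E)%E); last first.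
    apply: lte_mul_pinfty.
    - by apply: integral_ge0 => t _; rewrite lee_fin (rel_kernel_ge0 _ kA).
    - by apply: integrable_fin_num => //; case: kA.
    - exact: integrable_norm_lty.
  apply: le_trans (vop_norm_le kA mu_).
  apply: ge0_le_int.
  - apply: (@measurable_integral1 R (fun p => `|(F (p.2, p.1))%:E|%E)).
    apply: measurableT_comp => //; apply/measurable_EFinP.
    exact: (measurable_swap mF).
  - apply: (@measurable_integral1 R (fun p => `|A p.2 (p.1 - p.2) * u p.2|%:E)).
    apply/measurable_EFinP/measurableT_comp => //.
    exact: (measurable_swap mAu').
  - by move=> y; apply: integral_ge0.
  move=> y; apply: ge0_le_int => //.
  - apply: measurableT_comp => //; apply/measurable_EFinP.
    exact: (measurable_pair2 y mF).
  - apply/measurable_EFinP/measurableT_comp => //.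
    exact: (measurable_pair2 y mAu').
  - move=> s; rewrite /= lee_fin /F/= normrM ler_piMl// indicE.
    by case: (_ \in _); rewrite ?normr1 ?normr0.
have mAx (s : R) : mu.-integrable setT (EFin \o A s).
  case: kA => _ igam Ale; apply: L1_le igam => //.
  exact: (measurable_pair1 s mA).
have hB (s : R) : (\int[mu]_y (F (s, y))%:E = (\int[mu]_(t in `]-oo, x - s]) A s t * u s)%:E)%E.
  rewrite (@eq_int _ _ (fun y => (\1_`]-oo, x] y * A s (y - s))%:E * (u s)%:E)%E); last first.
    by move=> y; rewrite /F/= -EFinM mulrA.
  have iAs : mu.-integrable setT (EFin \o (fun z => \1_`]-oo, x - s] z * A s z)).
    apply: L1_le (integrable_norm (mAx s)) => //.
      by apply: measurable_funM => //; exact: L1_measurable (mAx s).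
    move=> z; rewrite normrM /= ler_piMl// indicE.
    by case: (_ \in _); rewrite ?normr1 ?normr0.
  have e z : \1_`]-oo, x] z * A s (z - s) = \1_`]-oo, x - s] (z - s) * A s (z - s).
    congr (_ * _); rewrite !indicE; congr ((_ : bool)%:R).
    by apply/idP/idP; rewrite !inE/= !in_itv/= lerBDr subrK.
  have iAs' := integrable_translation (- s) iAs.
  rewrite integralZr//; last first.
    by apply: eq_integrable iAs' => // z _; rewrite e.
  rewrite EFinM; congr (_ * _)%E.
  rewrite (@eq_int _ _ (fun y => (\1_`]-oo, x - s] (y - s) * A s (y - s))%:E)); last first.
    by move=> y; rewrite e.
  rewrite (@integral_translation R (- s) (fun z => (\1_`]-oo, x - s] z * A s z)%:E)); last first.
    by apply/measurable_EFinP; exact: L1_measurable iAs.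
  rewrite Rintegral_mkcond fineK; last first.
    apply: integrable_fin_num => //; apply: eq_integrable iAs => // z _ /=.
    by rewrite patchE indicE; case: (_ \in _); rewrite ?mul1r ?mul0r.
  apply: eq_int => z.
  by rewrite patchE indicE; case: (_ \in _); rewrite ?mul1r ?mul0r.
have -> : \int[mu]_(y in `]-oo, x]) vop A u y =
    \int[mu]_s (\int[mu]_(t in `]-oo, x - s]) A s t * u s).
  rewrite Rintegral_mkcond; congr fine.
  transitivity (\int[mu]_y \int[mu]_s (F (s, y))%:E)%E.
    apply: ae_eq_int.
    - apply/measurable_EFinP; apply/(measurable_restrictT _ _).1 => //.
      by apply: measurable_funTS; exact: L1_measurable iA.
    - apply: (@measurable_integral1 R (fun p => (F (p.2, p.1))%:E)).
      apply/measurable_EFinP.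
      exact: (measurable_swap mF).
    apply: (aeW (ae_integrable_vop kA iu)) => y iy.
    rewrite patchE /F/= indicE; case: (y \in _).
      rewrite fineK; last exact: integrable_fin_num.
      by apply: eq_int => s; rewrite mul1r.
    by rewrite (@eq_int _ _ (fun=> 0%E)) ?integral0// => s; rewrite mul0r.
  by rewrite -(Fubini iF)/=; apply: eq_int.
have iB : mu.-integrable setT (fun s => (\int[mu]_(t in `]-oo, x - s]) A s t * u s)%:E).
  by apply: eq_integrable (integrable_fubini_F iF) => // s _; rewrite /fubini_F /= hB.
have e1 (y : R) : ((fun y : R => g0 y * u y) \_ `]-oo, x]) y = (y <= x)%R%:R * g0 y * u y.
  rewrite patchE mem_setE in_itv/=.
  by case: (_ <= _); rewrite ?mul1r ?mul0r.
rewrite [X in _ = X + _]Rintegral_mkcond -RintegralD//.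
  by apply: eq_Rintegral => s _; rewrite mulrDl e1.
apply: L1_restrict => //; exact: integrableS ig0u.
Qed.
End comp.

(** * Absolutely continuous functions *)

Section ac.
Context {R : realType}.
Notation mu := (@lebesgue_measure R).
Implicit Types (f F G : R -> R) (a b c x y : R).

Lemma ae_on_ex a b (P : R -> Prop) x y : ae_on a b P -> a <= x -> x < y -> y <= b ->
  exists2 t, t \in `]x, y[ & P t.
Proof.
move=> [N [mN N0 hN]] ax xy yb; apply: contrapT => nex.
have sub : `]x, y[%classic `<=` N.
  move=> t txy; apply: hN => /= h; apply: nex; exists t => //; apply: h.
  by move: txy; rewrite /= !in_itv/= => /andP[xt ty]; rewrite (le_lt_trans ax)// (lt_le_trans ty).
have : (mu `]x, y[%classic <= mu N)%E by apply: le_measure; rewrite ?inE.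
rewrite N0 lebesgue_measure_itv/= lte_fin xy -EFinD lee_fin subr_le0 => yx.
by move: (lt_le_trans xy yx); rewrite ltxx.
Qed.

Definition primitive f x := \int[mu]_(t in `]-oo, x]) f t.

Lemma primitiveB f x y : mu.-integrable setT (EFin \o f) -> x <= y ->
  primitive f y - primitive f x = \int[mu]_(t in `]x, y[) f t.
Proof.
move=> fi xy; rewrite /primitive Rintegral_itvB ?bnd_simp//; last exact: integrableS fi.
by rewrite -Rintegral_itv_bndo_bndc//; exact: integrableS fi.
Qed.

Lemma integral_disjoint_itv n (x y : 'I_n -> R) (h : R -> \bar R) :
  trivIset setT (fun i => `]x i, y i[%classic) ->
  measurable_fun setT h -> (forall t, 0 <= h t)%E ->
  (\int[mu]_(t in \big[setU/set0]_i `]x i, y i[%classic) h t =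
   \sum_i \int[mu]_(t in `]x i, y i[) h t)%E.
Proof.
move=> xyd mh h0; rewrite ge0_integral_bigsetU//.
- exact: index_enum_uniq.
- by apply: sub_trivIset xyd.
- exact: measurable_funTS.
Qed.

Lemma measure_disjoint_itv n (x y : 'I_n -> R) :
  (forall i, x i <= y i) -> trivIset setT (fun i => `]x i, y i[%classic) ->
  mu (\big[setU/set0]_i `]x i, y i[%classic) = (\sum_i (y i - x i))%:E.
Proof.
move=> xy xyd.
have mU : measurable (\big[setU/set0]_i `]x i, y i[%classic) by exact: bigsetU_measurable.
rewrite -[LHS]mul1e -integral_cst// integral_disjoint_itv// -sumEFin.
apply: eq_bigr => i _; rewrite integral_cst// mul1e.
apply: (etrans (lebesgue_measure_itv `]x i, y i[)); rewrite /= lte_fin.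
by case: ltP => [_|yx]; rewrite -?EFinD//; rewrite (@le_anti _ _ (x i) (y i)) ?subrr// xy yx.
Qed.

(** Absolute continuity of the integral of |f|, applied to the union of the disjoint intervals,
    whose measure is the sum of their lengths. *)
Lemma primitive_ac f a b : mu.-integrable setT (EFin \o f) -> abs_continuous a b (primitive f).
Proof.
move=> fi e e0; have [d [d0 hd]] := integral_normr_continuous fi e0.
exists d => // n x y xy xyd sd.
have xy' i : x i <= y i by case: (xy i).
pose D := \big[setU/set0]_i `]x i, y i[%classic.
have mD : measurable D by exact: bigsetU_measurable.
have muD : (mu D < d%:E)%E by rewrite measure_disjoint_itv// lte_fin.
have := hd D mD muD.
apply: le_lt_trans.
have fi' : mu.-integrable setT (EFin \o (fun t => `|f t|)) := integrable_norm fi.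
rewrite /Rintegral integral_disjoint_itv//; last first.
  by apply/measurable_EFinP; exact: L1_measurable fi'.
rewrite -sum_fine; last first.
  by move=> i _; apply: integrable_fin_num => //; exact: integrableS fi'.
apply: ler_sum => i _; rewrite primitiveB//.
by apply: le_normr_Rintegral => //; exact: integrableS fi.
Qed.

Lemma abs_continuousB a b F G : abs_continuous a b F -> abs_continuous a b G ->
  abs_continuous a b (F \- G).
Proof.
move=> acF acG e e0; have e20 : 0 < e / 2 by rewrite divr_gt0.
have [d1 d10 h1] := acF _ e20; have [d2 d20 h2] := acG _ e20.
exists (Num.min d1 d2); first by rewrite lt_min d10.
move=> n x y xy xyd; rewrite lt_min => /andP[s1 s2].
rewrite [e]splitr; apply: (le_lt_trans _ (ltrD (h1 n x y xy xyd s1) (h2 n x y xy xyd s2))).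
rewrite -big_split/=; apply: ler_sum => i _.
have -> : (F \- G) (y i) - (F \- G) (x i) = (F (y i) - F (x i)) - (G (y i) - G (x i)) by rewrite /=; ring.
exact: ler_normB.
Qed.

Lemma abs_continuousW a b c e F : abs_continuous a b F -> a <= c -> e <= b ->
  abs_continuous c e F.
Proof.
move=> acF ac eb r r0; have [d d0 h] := acF _ r0; exists d => // n x y xy.
apply: h => i; have [cx xyi ye] := xy i; split => //; first exact: le_trans cx.
exact: le_trans ye _.
Qed.

Lemma abs_continuous_near a b F x e : abs_continuous a b F -> a <= x <= b -> 0 < e ->
  exists2 d, 0 < d & forall y, a <= y <= b -> `|y - x| < d -> `|F y - F x| < e.
Proof.
move=> acF /andP[ax xb] e0; have [d d0 h] := acF _ e0; exists d => // y /andP[ay yb] yxd.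
have [xy|yx] := leP x y.
  have := h 1 (fun=> x) (fun=> y); rewrite !big_ord1; apply => //.
  - by move=> i j _ _ _; rewrite !ord1.
  - by rewrite ger0_norm ?subr_ge0// in yxd.
have := h 1 (fun=> y) (fun=> x); rewrite !big_ord1 distrC; apply => //.
- by move=> i; split => //; exact: ltW.
- by move=> i j _ _ _; rewrite !ord1.
- by rewrite distrC ger0_norm ?subr_ge0// in yxd; exact: ltW.
Qed.

(** Compactness of the interval as an induction: the step at the supremum of the points satisfying
    [P] carries [P] beyond it, unless it is [b]. Taking x <= c <= y in a single step covers both
    reaching c from the left and leaving it to the right. *)
Lemma real_induction a b (P : R -> Prop) : a <= b -> P a ->
  (forall c, a <= c <= b -> exists2 d, 0 < d &
     forall x y, a <= x -> x <= c -> c <= y -> y <= b -> c - d < x -> y < c + d ->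
       P x -> P y) -> P b.
Proof.
move=> ab Pa step; pose S := [set x | a <= x <= b /\ P x].
have Sa : S a by split => //; rewrite lexx.
have Sub : has_ubound S by exists b => x [/andP[]].
have hs : has_sup S by split => //; exists a.
have ac : a <= sup S by exact: ub_le_sup.
have cb : sup S <= b by apply: ge_sup; [exists a|move=> x [/andP[]]].
have [|d d0 hd] := step (sup S); first by rewrite ac.
have [x Sx cdx] := sup_adherent d0 hs.
have xc : x <= sup S by exact: ub_le_sup.
pose y := Num.min b (sup S + d / 2).
have Py : P y.
  apply: (hd x) => //; case: Sx => // /andP[ax _] _ //.
  - by rewrite le_min cb lerDl divr_ge0// ltW.
  - by rewrite ge_min lexx.
  - by rewrite gt_min ltrD2l ltr_pdivrMr// ltr_pMr// ltr1n orbT.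
have yb : y <= b by rewrite ge_min lexx.
have ay : a <= y by rewrite le_min ab (le_trans ac)// lerDl divr_ge0// ltW.
have : y <= sup S by apply: ub_le_sup => //; split => //; rewrite ay yb.
rewrite {1}/y ge_min => /orP[bc|]; last first.
  by rewrite gerDl leNgt divr_gt0.
suff <- : y = b by [].
by apply/min_idPl; rewrite (le_trans bc)// lerDl divr_ge0// ltW.
Qed.

Lemma derive1B F G x a b : derivable F x 1 -> derive1 F x = a ->
  derivable G x 1 -> derive1 G x = b ->
  derivable (F \- G) x 1 /\ derive1 (F \- G) x = a - b.
Proof.
move=> dF <- dG <-; split; first exact: derivableB.
by rewrite !derive1E; exact: deriveB.
Qed.

Lemma derivable_small F c e : derivable F c 1 -> 0 < e ->
  exists2 d, 0 < d & forall y, `|y - c| < d ->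
    `|F y - F c - derive1 F c * (y - c)| <= e * `|y - c|.
Proof.
move=> dF e0.
have : (fun h => h^-1 *: (F (h *: 1 + c) - F c)) @ 0^' --> derive1 F c.
  by rewrite derive1E; exact: dF.
move: (derive1 F c) => l.
move=> /cvgrPdist_le /(_ e e0); rewrite near_withinE => -[d /= d0 hd].
exists d => // y yc; have [->|yc0] := eqVneq y c.
  by rewrite !subrr mulr0 subr0 normr0 mulr0.
have := hd (y - c); rewrite /ball/= sub0r normrN => /(_ yc).
rewrite subr_eq0 => /(_ yc0); rewrite /GRing.scale/= mulr1 subrK distrC => h.
have yc' : y - c != 0 by rewrite subr_eq0.
rewrite (_ : F y - F c - l * (y - c) = ((y - c)^-1 * (F y - F c) - l) * (y - c)); last by field.
by rewrite normrM ler_wpM2r.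
Qed.

(* [P x] below: up to [x], the increments of [F] are controlled either by the
   derivative or by finitely many disjoint intervals inside an open set [U] of
   small measure that covers the exceptional null set. *)
Lemma abs_continuous_nonincreasing a b F : a <= b -> abs_continuous a b F ->
  ae_on a b (fun t => derivable F t 1 /\ derive1 F t <= 0) -> F b <= F a.
Proof.
move=> ab acF [N [mN N0 hN]].
suff h e : 0 < e -> F b - F a <= e * (b - a) + e.
  rewrite -subr_le0; apply/ler_addgt0Pl => e e0; rewrite addr0.
  have e10 : 0 < e / (b - a + 1) by rewrite divr_gt0// ltr_wpDl// subr_ge0.
  apply: le_trans (h _ e10) _; rewrite -[X in _ + X]mulr1 -mulrDr divfK//.
  by rewrite gt_eqF// ltr_wpDl// subr_ge0.
move=> e0; have [d d0 hd] := acF _ e0.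
(* The end points join the exceptional set because the hypothesis on the derivative concerns only
   the open interval. *)
pose N' := N `|` [set a] `|` [set b].
have mN' : measurable N' by apply: measurableU => //; exact: measurableU.
have N'0 : mu N' = 0%E.
  have Na0 : mu (N `|` [set a]) = 0%E by rewrite measureU0//; exact: lebesgue_measure_set1.
  by rewrite measureU0//; [exact: measurableU|exact: lebesgue_measure_set1].
have muN' : (mu N' < +oo)%E by rewrite N'0.
have [U [oU NU Ud]] := lebesgue_regularity_outer mN' muN' d0.
have mU : measurable U := open_measurable oU.
have muU : (mu U < d%:E)%E.
  have mUN : measurable (U `\` N') by apply: measurableD.
  rewrite (_ : mu U = mu (U `\` N'))//.
  by rewrite -[in LHS](setDUK NU) setUC measureU0.
pose P x := exists s : seq (R * R),
  [/\ all (fun p => [&& a <= p.1, p.1 <= p.2 & p.2 <= x]) s,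
      (forall p, p \in s -> `]p.1, p.2[%classic `<=` U),
      pairwise (fun p q => p.2 <= q.1) s &
      F x - F a <= e * (x - a) + \sum_(p <- s) `|F p.2 - F p.1|].
have : P b.
  apply: (real_induction ab).
    by exists [::]; split => //; rewrite big_nil !subrr mulr0 addr0.
  move=> c /andP[ac cb]; have [Uc|nUc] := pselect (U c).
    have [r r0 hr] : exists2 r, 0 < r & ball c r `<=` U.
      by move: oU; rewrite openE => /(_ _ Uc); rewrite /interior => /nbhs_ballP[r]; exists r.
    exists r => // x y ax xc cy yb crx ycr [s [s1 s2 s3 s4]].
    have xy : x <= y := le_trans xc cy.
    exists (rcons s (x, y)); split.
    - rewrite all_rcons/= ax xy lexx/=; apply/allP => p /(allP s1) /and3P[-> -> px] /=.
      exact: le_trans xy.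
    - move=> p; rewrite mem_rcons inE => /orP[/eqP ->/= t|/s2//].
      rewrite /= in_itv/= => /andP[xt ty]; apply: hr; rewrite /ball/= ltr_distlC.
      by rewrite (lt_trans crx)// (lt_trans ty).
    - by rewrite pairwise_rcons s3 andbT; apply/allP => p /(allP s1) /and3P[].
    - rewrite -cats1 big_cat/= big_seq1/= (_ : F y - F a = (F x - F a) + (F y - F x)); last by ring.
      rewrite [leRHS]addrA; apply: lerD; last exact: ler_norm.
      by apply: le_trans s4 _; rewrite lerD2r ler_pM2l// lerD2r.
  have cN' : ~ N' c by move=> /NU.
  have [ca cb' cN] : [/\ c <> a, c <> b & ~ N c].
    by split => h; apply: cN'; [left; right|right|left; left].
  have [dF F0] : derivable F c 1 /\ derive1 F c <= 0.
    apply: contrapT => h; apply: cN; apply: hN => /= h'; apply: h; apply: h'.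
    by rewrite in_itv/= !lt_neqAle ac cb !andbT; apply/andP; split; apply/eqP => // /esym.
  have [r r0 hr] := derivable_small dF e0.
  exists r => // x y ax xc cy yb crx ycr [s [s1 s2 s3 s4]].
  exists s; split => //.
    by apply/allP => p /(allP s1) /and3P[-> -> px] /=; rewrite (le_trans px)// (le_trans xc).
  have h1 : F y - F c <= e * (y - c).
    have := hr y; rewrite ger0_norm ?subr_ge0// ltrBlDl => /(_ ycr) /(le_trans (ler_norm _)).
    rewrite lerBlDr => /le_trans; apply; rewrite gerDl.
    by rewrite mulr_le0_ge0// subr_ge0.
  have h2 : F c - F x <= e * (c - x).
    have := hr x; rewrite (ler0_norm (x := x - c)) ?subr_le0// opprB ltrBlDr -ltrBlDl => /(_ crx).
    rewrite -normrN => /(le_trans (ler_norm _)) h.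
    have h3 : derive1 F c * (c - x) <= 0 by rewrite mulr_le0_ge0// subr_ge0.
    rewrite (_ : F c - F x = - (F x - F c - derive1 F c * (x - c)) + derive1 F c * (c - x)); last by ring.
    by rewrite -[leRHS]addr0 lerD.
  rewrite (_ : F y - F a = (F x - F a) + ((F y - F c) + (F c - F x))); last by ring.
  apply: le_trans (lerD s4 (lerD h1 h2)) _.
  by rewrite le_eqVlt; apply/orP; left; apply/eqP; ring.
move=> [s [s1 s2 s3 s4]]; apply: le_trans s4 _; rewrite lerD2l ltW//.
rewrite (big_nth (0, 0)) big_mkord.
pose x (i : 'I_(size s)) := (nth (0, 0) s i).1; pose y (i : 'I_(size s)) := (nth (0, 0) s i).2.
have sP (i : 'I_(size s)) : nth (0, 0) s i \in s by exact: mem_nth.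
have xyi i : [/\ a <= x i, x i <= y i & y i <= b] by have /and3P[] := allP s1 _ (sP i).
have dis : trivIset setT (fun i => `]x i, y i[%classic).
  have ltd (i j : 'I_(size s)) t : (i < j)%N -> `]x i, y i[%classic t -> `]x j, y j[%classic t -> False.
    move=> ij; rewrite /= !in_itv/= => /andP[_ ty] /andP[xt _].
    have /(_ i j (ltn_ord i) (ltn_ord j) ij) : {in gtn (size s) &, {homo nth (0, 0) s : i j / (i < j)%N >-> i.2 <= j.1}} by apply/pairwiseP.
    by move=> yx; move: (lt_trans (lt_le_trans ty yx) xt); rewrite ltxx.
  move=> i j _ _ [t [ti tj]]; apply: val_inj => /=.
  by case: (ltngtP i j) => // ij; [case: (ltd i j t)|case: (ltd j i t)].
apply: (hd _ x y) => //.
rewrite -lte_fin -measure_disjoint_itv//; last by move=> i; case: (xyi i).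
apply: le_lt_trans muU; apply: le_measure; rewrite ?inE//.
  exact: bigsetU_measurable.
by move=> t; rewrite -bigcup_seq => -[i _]; exact: s2.
Qed.

Lemma abs_continuous_cst a b F : a <= b -> abs_continuous a b F ->
  ae_on a b (fun t => derivable F t 1 /\ derive1 F t = 0) -> F b = F a.
Proof.
move=> ab acF aeF; apply/eqP; rewrite eq_le; apply/andP; split.
  apply: (abs_continuous_nonincreasing ab acF).
  by apply: aeW aeF _ => t h /h [dF ->].
have ac0 : abs_continuous a b (fun=> 0 : R).
  move=> e e0; exists 1; first exact: ltr01.
  by move=> n x y _ _ _; rewrite big1// => i _; rewrite subrr normr0.
have acN := abs_continuousB ac0 acF.
have := abs_continuous_nonincreasing ab acN; rewrite /= !sub0r lerN2; apply.
apply: aeW aeF _ => t h /h [dF F0].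
have dc : derivable (fun=> 0 : R) t 1 by exact: derivable_cst.
have d0 : derive1 (fun=> 0 : R) t = 0 by rewrite derive1_cst.
by have [dN ->] := derive1B dc d0 dF F0; rewrite subrr.
Qed.

Lemma primitive_derive f : mu.-integrable setT (EFin \o f) ->
  {ae mu, forall x, derivable (primitive f) x 1 /\ derive1 (primitive f) x = f x}.
Proof.
move=> fi; apply: FTC1Ny; first by move=> y; exact: integrableS fi.
by apply: open_integrable_locally => //; exact: openT.
Qed.

(** Both F and -F, minus the primitive of [h], have a nonpositive derivative almost everywhere,
    hence do not increase from [a] to [b]. *)
Lemma abs_continuous_diff_le a b F h : abs_continuous a b F -> a <= b ->
  mu.-integrable setT (EFin \o h) ->
  ae_on a b (fun t => derivable F t 1 /\ `|derive1 F t| <= h t) ->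
  `|F b - F a| <= primitive h b - primitive h a.
Proof.
move=> acF ab ih aeF; have ach := primitive_ac a b ih.
have ac0 : abs_continuous a b (fun=> 0 : R).
  move=> e e0; exists 1; first exact: ltr01.
  by move=> n x y _ _ _; rewrite big1// => i _; rewrite subrr normr0.
have h1 : F b - primitive h b <= F a - primitive h a.
  apply: (abs_continuous_nonincreasing ab (abs_continuousB acF ach)).
  apply: (aeW2 aeF (primitive_derive ih)) => t hF [dp pd] /hF [dF Fh].
  have [dB ->] := derive1B dF erefl dp pd; split => //.
  by rewrite subr_le0 (le_trans (ler_norm _)).
have h2 : (0 - F b) - primitive h b <= (0 - F a) - primitive h a.
  apply: (abs_continuous_nonincreasing ab (abs_continuousB (abs_continuousB ac0 acF) ach)).
  apply: (aeW2 aeF (primitive_derive ih)) => t hF [dp pd] /hF [dF Fh].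
  have dc : derivable (fun=> 0 : R) t 1 by exact: derivable_cst.
  have d0 : derive1 (fun=> 0 : R) t = 0 by rewrite derive1_cst.
  have [dN eN] := derive1B dc d0 dF erefl.
  have [dB ->] := derive1B dN eN dp pd; split => //.
  by rewrite sub0r subr_le0 (le_trans _ Fh)// -normrN ler_norm.
by rewrite ler_norml; move: h1 h2; lra.
Qed.

Lemma abs_continuous_FTC a b F h : abs_continuous a b F ->
  mu.-integrable setT (EFin \o h) ->
  ae_on a b (fun t => derivable F t 1 /\ derive1 F t = h t) ->
  forall t, a <= t <= b -> F t = F a + (primitive h t - primitive h a).
Proof.
move=> acF ih aeF t /andP[at_ tb].
have acD : abs_continuous a t (F \- primitive h).
  by apply: abs_continuousB; [exact: abs_continuousW acF _ _|exact: primitive_ac].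
have := abs_continuous_cst at_ acD; rewrite /= => e.
suff : F t - primitive h t = F a - primitive h a by move=> e'; rewrite -(subrK (primitive h t) (F t)) e'; ring.
apply: e; apply: aeW2 aeF (primitive_derive ih) _ => x hx [dp ph] xat.
have [|dF Fh] := hx.
  by move: xat; rewrite !in_itv/= => /andP[-> xt]; rewrite (lt_le_trans xt).
by have := derive1B dF Fh dp ph; rewrite subrr.
Qed.

(** Continuity upgrades the almost everywhere equality of the primitives to equality at every point
    of []0, b[]; it can then be differentiated. This is how an integrated identity is turned back
    into a second-kind equation. *)
Lemma primitive_ae_inj b f1 f2 : mu.-integrable setT (EFin \o f1) ->
  mu.-integrable setT (EFin \o f2) ->
  ae_on 0 b (fun x => primitive f1 x = primitive f2 x) ->
  ae_on 0 b (fun x => f1 x = f2 x).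
Proof.
move=> i1 i2 e.
have ac : abs_continuous 0 b (primitive f1 \- primitive f2).
  by apply: abs_continuousB; exact: primitive_ac.
have D0 x : 0 < x < b -> primitive f1 x - primitive f2 x = 0.
  move=> /andP[x0 xb]; apply/eqP; rewrite -normr_le0; apply/ler_addgt0Pl => r r0; rewrite addr0.
  have [|d d0 hd] := abs_continuous_near ac _ r0 (x := x); first by rewrite !ltW.
  have [|||t] := ae_on_ex e (x := x) (y := Num.min b (x + d)); first exact: ltW.
  - by rewrite lt_min xb ltrDl.
  - by rewrite ge_min lexx.
  rewrite in_itv/= lt_min => /and3P[xt tb txd] et.
  have := hd t; rewrite /= et subrr sub0r normrN => h; apply: ltW; apply: h.
    by rewrite !ltW// (lt_trans x0).
  by rewrite gtr0_norm ?subr_gt0// ltrBlDl.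
apply: aeW2 (primitive_derive i1) (primitive_derive i2) _ => x [d1 p1] [d2 p2] x0b.
have [_] := derive1B d1 p1 d2 p2.
rewrite (_ : derive1 _ x = 0); first by move=> /esym/eqP; rewrite subr_eq0 => /eqP.
rewrite derive1E (@near_eq_derive _ _ _ _ (cst 0)) ?derive_cst//.
near=> z.
rewrite /= -[LHS]/(primitive f1 z - primitive f2 z) D0//.
by near: z; have := near_in_itvoo x0b; apply: filterS => z; rewrite in_itv.
Unshelve. all: by end_near. Qed.

End ac.

(** * Borel versions of Caratheodory functions *)

Section cara.
Context {R : realType}.
Notation mu := (@lebesgue_measure R).

Lemma bigcup_int_measurable (F : int -> set R) : (forall k, measurable (F k)) ->
  measurable (\bigcup_k F k).
Proof.
move=> mF; rewrite (_ : \bigcup_k F k = \bigcup_n F (odflt 0 (unpickle n))).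
  exact: bigcupT_measurable.
apply/seteqP; split => [x [k _ xk]|x [n _ xn]]; last by exists (odflt 0 (unpickle n)).
by exists (pickle k) => //; rewrite pickleK.
Qed.

Lemma measurable_fun_floor (F : int -> R) (c : R) : 0 < c ->
  measurable_fun setT (fun t : R => F (Num.floor (t * c))).
Proof.
move=> c0 _ B mB; rewrite setTI.
rewrite (_ : _ @^-1` B = \bigcup_k (if F k \in B then
    `[k%:~R / c, (k%:~R + 1) / c[%classic else set0)).
  by apply: bigcup_int_measurable => k; case: ifP.
have fl t k : (`[k%:~R / c, (k%:~R + 1) / c[%classic t : Prop) <-> Num.floor (t * c) = k.
  rewrite /= in_itv/= ler_pdivrMr// ltr_pdivlMr//; split.
    by move=> /andP[h1 h2]; apply: floor_def; rewrite h1 intrD.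
  by move=> <-; rewrite ge_floor; have := @floorD1_gt R (t * c); rewrite intrD.
apply/seteqP; split => [t Bt|t [k _]].
  by exists (Num.floor (t * c)) => //; rewrite mem_set//; apply/fl.
by case: ifPn => //; rewrite inE => Bk /fl tk; rewrite /= tk.
Qed.

(** For each rational r, the part of [D] where q > r differs from a Borel set by a null set.
    Removing the union of these countably many null sets makes all these preimages Borel at once. *)
Lemma completed_borel_version (D : set (R * R)) (q : R -> R -> R) :
  measurable D -> measurable2_on D q ->
  exists N : set (R * R), [/\ measurable N, (mu \x mu)%E N = 0%E &
    measurable_fun setT ((fun p => q p.1 p.2) \_ (D `\` N))].
Proof.
move=> mD mq; pose r n : R := ratr (odflt 0 (unpickle n)).
have /choice[N hN] n : exists N : set (R * R), [/\ measurable N, (mu \x mu)%E N = 0%E &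
    exists A, measurable A /\ (D `&` [set p | r n < q p.1 p.2]) `\` N = A `\` N].
  have [A mA [M [N [mN N0 MN]] AM]] := mq `]r n, +oo[%classic (measurable_itv _).
  exists N; split => //; exists A; split => //.
  rewrite (_ : D `&` _ = A `|` M); last first.
    by rewrite AM; congr (_ `&` _); apply/seteqP; split => p /=; rewrite in_itv/= andbT.
  by rewrite setDUl (_ : M `\` N = set0) ?setU0//; apply/seteqP; split => // p [/MN].
pose N' := \bigcup_n N n.
have mN' : measurable N' by apply: bigcupT_measurable => n; case: (hN n).
exists N'; split => //.
  apply/negligibleP => //; apply: negligible_bigcup => n.
  by have [mNn Nn0 _] := hN n; apply/negligibleP.
set f := _ \_ _.
have mf n : measurable (f @^-1` `]r n, +oo[%classic).
  have [mNn Nn0 [A [mA hA]]] := hN n.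
  (* Off [D] minus the null set the extension takes the value 0, which lies in the ray exactly when
     its end point is negative. *)
  rewrite (_ : _ @^-1` _ = (A `\` N') `|` (if r n < 0 then ~` (D `\` N') else set0)).
    apply: measurableU; first exact: measurableD.
    by case: ifP => // _; apply: measurableC; exact: measurableD.
  have sub p : ~ N' p -> A p <-> D p /\ r n < q p.1 p.2.
    move=> nN; have nNn : ~ N n p by move=> h; apply: nN; exists n.
    split => [Ap|[Dp qp]].
      by have : (A `\` N n) p by []; rewrite -hA => -[].
    by have : ((D `&` [set p | r n < q p.1 p.2]) `\` N n) p by []; rewrite hA => -[].
  apply/seteqP; split => p.
    rewrite /= in_itv/= andbT /f patchE; case: ifPn.
      by rewrite inE => -[Dp Np] qp; left; split => //; apply/(sub _ Np).
    by move=> /negP h -> ; right => h'; apply: h; rewrite inE.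
  move=> [[Ap Np]|].
    have [Dp qp] := (sub _ Np).1 Ap.
    by rewrite /= in_itv/= andbT /f patchE ifT// inE.
  case: ifP => // rn h; rewrite /= in_itv/= andbT /f patchE ifF//.
  by apply/negP; rewrite inE.
apply: (measurability _ (RGenOInfty.measurableE R)) => _ [_ [x ->] <-]; rewrite setTI.
rewrite (_ : _ @^-1` _ = \bigcup_n (if x < r n then f @^-1` `]r n, +oo[%classic else set0)).
  by apply: bigcupT_measurable => n; case: ifP.
apply/seteqP; split => p /=.
  rewrite in_itv/= andbT => /rat_in_itvoo[s]; rewrite in_itv/= => /andP[xs sf].
  by exists (pickle s) => //=; rewrite /r pickleK/= xs /= in_itv/= sf.
move=> [n _]; case: ifP => // xr; rewrite /= in_itv/= andbT => rf.
by rewrite in_itv/= (lt_trans xr).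
Qed.

Lemma null_ysection (N : set (R * R)) : measurable N -> (mu \x mu)%E N = 0%E ->
  {ae mu, forall t, mu (ysection N t) = 0%E}.
Proof.
move=> mN N0.
have mf : measurable_fun [set: R * R] (fun p => (\1_N p : R)%:E).
  by apply/measurable_EFinP.
have f0 (p : R * R) : (0 <= (\1_N p : R)%:E)%E by rewrite lee_fin.
have := @fubini_tonelli2 _ _ _ _ R mu mu (fun p : R * R => (\1_N p : R)%:E) mf f0.
have -> : (\int[mu \x mu]_z (\1_N z : R)%:E = 0)%E.
  by apply: (etrans (integral_indic _ _ _)) => //; rewrite setIT.
move=> /esym h.
have mG := @measurable_fun_fubini_tonelli_G _ _ _ _ R mu (fun p : R * R => (\1_N p : R)%:E) mf f0.
have := (ae_eq_integral_abs mu measurableT mG).1.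
have -> : (\int[mu]_x `|fubini_G mu (fun p => (\1_N p)%:E) x| = 0)%E.
  rewrite -[RHS]h; apply: eq_integral => t _; rewrite gee0_abs//.
  by apply: integral_ge0 => s _.
move=> /(_ erefl) ae; apply: aeW ae _ => t /(_ I) /=.
by rewrite indic_fubini_tonelli_GE.
Qed.

(* [q (s, t)] is the limit of [q (s, t_n)], where [t_n > t] ranges over a countable
   grid chosen among the levels whose section of the exceptional planar null set
   is null; [Z] is the countable union of these sections. *)
Lemma caratheodory_borel (D : set (R * R)) (q : R -> R -> R) :
  measurable D -> measurable2_on D q ->
  exists Z : set R, [/\ measurable Z, mu Z = 0%E & exists qt : R * R -> R,
    measurable_fun setT qt /\ forall s t, ~ Z s ->
    (exists2 e : R, 0 < e & forall y : R, t <= y -> y < t + e -> D (s, y)) ->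
    (forall r : R, 0 < r -> exists2 d : R, 0 < d & forall y : R, t <= y -> y < t + d -> `|q s y - q s t| < r) ->
    qt (s, t) = q s t].
Proof.
move=> mD /(completed_borel_version mD)[N [mN N0 mq1]].
set q1 := _ \_ _ in mq1.
have good := null_ysection mN N0.
(* The cell is shifted by one, so that with k the floor of t(n+1) the level lies strictly to the
   right of t and within 2/(n+1) of it. *)
have /choice[tau htau] (nk : nat * int) : exists t, mu (ysection N t) = 0%E /\
    (nk.2%:~R + 1) / nk.1.+1%:R < t < (nk.2%:~R + 2) / nk.1.+1%:R.
  set lo := (_ / _); set hi := (_ / _).
  have lohi : lo < hi by rewrite ltr_pM2r ?invr_gt0// ltrD2l ltr1n.
  have := @ae_on_ex R lo hi (fun t => mu (ysection N t) = 0%E) lo hi.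
  case=> //; first by apply: aeW good _.
  by move=> t; rewrite in_itv/= => tlh tN; exists t.
pose Z := \bigcup_j ysection N (tau (odflt (0%N, 0) (unpickle j))).
have mZ : measurable Z by apply: bigcupT_measurable => j; exact: measurable_ysection.
have Z0 : mu Z = 0%E.
  apply/negligibleP => //; apply: negligible_bigcup => n.
  by apply/negligibleP; [exact: measurable_ysection|case: (htau (odflt (0%N, 0) (unpickle n)))].
exists Z; split => //.
pose tn (n : nat) (t : R) : R := tau (n, Num.floor (t * n.+1%:R)).
have mtn n : measurable_fun setT (tn n).
  exact: (@measurable_fun_floor (fun k => tau (n, k))).
pose qn (n : nat) (p : R * R) : R := q1 (p.1, tn n p.2).
have mqn n : measurable_fun setT (qn n).
  apply: (measurableT_comp mq1); apply/measurable_fun_pair => //=.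
  exact: measurableT_comp.
(* The upper limit is measurable on the whole plane and equals the limit wherever the latter
   exists. *)
exists (fun p => fine (limn_esup (fun n => (qn n p)%:E))); split.
  apply: measurableT_comp => //.
  by apply: measurable_fun_limn_esup => n; apply/measurable_EFinP.
move=> s t nZ [e e0 hD] hq.
have tnt n : t < tn n t < t + 2 / n.+1%:R.
  have [_] := htau (n, Num.floor (t * n.+1%:R)); rewrite -/(tn n t) /= => /andP[h1 h2].
  have n0 : (0 : R) < n.+1%:R by [].
  apply/andP; split.
    apply: lt_trans h1; rewrite ltr_pdivlMr//; have := @floorD1_gt R (t * n.+1%:R).
    by rewrite intrD.
  apply: (lt_le_trans h2); rewrite ler_pdivrMr// mulrDl divfK ?gt_eqF// lerD2r.
  exact: ge_floor.
suff h : (qn n (s, t))%:E @[n --> \oo] --> (q s t)%:E.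
  by rewrite /= is_cvg_limn_esupE ?(cvg_lim _ h)//; apply/cvg_ex; exists (q s t)%:E.
apply: cvg_EFin; first by near=> n.
apply/cvgrPdist_lt => r r0; have [d d0 hd] := hq _ r0.
have m0 : 0 < Num.min e d / 2 by rewrite divr_gt0// lt_min e0.
near=> n.
have h2 : 2 / n.+1%:R < Num.min e d.
  rewrite mulrC -ltr_pdivlMr//.
  by near: n; exact: (near_infty_natSinv_lt (PosNum m0)).
have /andP[t1 t2] := tnt n.
have [te td] : tn n t < t + e /\ tn n t < t + d.
  by move: h2; rewrite lt_min => /andP[he hd']; split; apply: (lt_trans t2); rewrite ltrD2l.
rewrite /= /qn /q1 patchE ifT; last first.
  rewrite inE; split; first by apply: hD => //; exact: ltW.
  move=> Nst; apply: nZ; exists (pickle (n, Num.floor (t * n.+1%:R))) => //.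
  by rewrite pickleK/= /ysection/= inE.
by rewrite distrC; apply: hd => //; exact: ltW.
Unshelve. all: by end_near.
Qed.

End cara.

(** * Volterra equations of the second kind *)

Section volterra2.
Context {R : realType}.
Notation mu := (@lebesgue_measure R).
Implicit Types (f u v w : R -> R).

(** For y nonzero 1/y = y exp(- ln y^2), and the factor y reproduces the convention that the inverse
    of 0 is 0. *)
Lemma measurable_funV f : measurable_fun setT f -> measurable_fun setT (fun x => (f x)^-1).
Proof.
move=> mf; rewrite (_ : (fun x => _) = (fun x => f x * expR (- ln (f x ^+ 2)))).
  apply: measurable_funM => //; apply: measurableT_comp => //; apply: measurableT_comp => //.
  apply: (measurableT_comp (@measurable_ln R)); exact: measurable_funX.
apply/funext => x; have [->|fx0] := eqVneq (f x) 0; first by rewrite invr0 mul0r.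
by rewrite expRN lnK ?posrE ?exprn_even_gt0//; field.
Qed.

(** The Riesz-Fischer argument: the sum [T] of the absolute increments is integrable, hence finite
    almost everywhere, so the series converges absolutely there; [T] then dominates the sequence. *)
Lemma L1_complete (U : nat -> R -> R) (c : R) : 0 <= c -> (forall x, U 0%N x = 0) ->
  (forall n, mu.-integrable setT (EFin \o U n)) ->
  (forall n, (\int[mu]_x `|U n.+1 x - U n x|%:E <= (c / (2 ^ n.+1)%:R)%:E)%E) ->
  exists2 u, mu.-integrable setT (EFin \o u) &
    (\int[mu]_x `|U n x - u x|%:E)%E @[n --> \oo] --> 0%E.
Proof.
move=> c0 U0 iU dU; have mU n := L1_measurable (iU n).
pose e (n : nat) (x : R) : R := U n.+1 x - U n x.
have me n : measurable_fun setT (e n) by exact: measurable_funB.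
have me' n : measurable_fun setT (fun x => `|e n x|%:E).
  by apply/measurable_EFinP/measurableT_comp.
pose T (x : R) : \bar R := (\sum_(0 <= n <oo) `|e n x|%:E)%E.
have mT : measurable_fun setT T by apply: ge0_emeasurable_sum.
have T0 x : (0 <= T x)%E by apply: nneseries_ge0.
have UE x : (U ^~ x) = series (e ^~ x).
  by apply/funext => n; rewrite /series/= telescope_sumr// U0 subr0.
have iT : mu.-integrable setT T.
  apply/integrableP; split => //.
  rewrite (@eq_int _ _ T); last by move=> x; rewrite gee0_abs.
  rewrite integral_nneseries//.
  (* The zero main term puts the geometric bounds in the form expected by [epsilon_trick], which
     sums them to at most c. *)
  apply: (@le_lt_trans _ _ (\sum_(0 <= n <oo) (0 + (c / (2 ^ n.+1)%:R)%:E))%E).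
    by apply: lee_nneseries => [n _ _|n _]; [exact: integral_ge0|rewrite add0e; exact: dU].
  apply: (le_lt_trans (epsilon_trick xpredT (fun=> lexx 0%E) c0)).
  by rewrite eseries0// add0e ltry.
have UT n x : (`|U n x|%:E <= T x)%E.
  rewrite (_ : U n x = series (e ^~ x) n); last by rewrite -UE.
  apply: (@le_trans _ _ (\sum_(0 <= k < n) `|e k x|%:E)%E); last exact: nneseries_lim_ge.
  by rewrite sumEFin lee_fin; exact: ler_norm_sum.
pose u x := fine (limn_esup (fun n => (U n x)%:E)).
have mu_ : measurable_fun setT u.
  by apply: measurableT_comp => //; apply: measurable_fun_limn_esup => n; apply/measurable_EFinP.
have cvgU : {ae mu, forall x, U n x @[n --> \oo] --> u x}.
  apply: (aeW (integrable_ae measurableT iT)) => x /(_ I) Tx.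
  suff h : cvgn (U ^~ x).
    have h' : (U n x)%:E @[n --> \oo] --> (limn (U ^~ x))%:E by apply: cvg_EFin => //; near=> n.
    by rewrite /u is_cvg_limn_esupE ?(cvg_lim _ h')//; apply/cvg_ex; eexists; exact: h'.
  rewrite UE; apply: normed_cvg; apply: nondecreasing_is_cvgn.
    exact: (nondecreasing_series (fun k _ _ => normr_ge0 (e k x))).
  exists (fine (T x)) => _ [n _ <-]; rewrite -lee_fin fineK//.
  by rewrite /series/= -sumEFin; exact: nneseries_lim_ge.
have [|||||iu h _] := @dominated_convergence _ _ _ mu setT measurableT
   (fun n x => (U n x)%:E) (EFin \o u) T.
- by move=> n; apply/measurable_EFinP; exact: mU.
- by apply/measurable_EFinP; exact: mu_.
- by apply: aeW cvgU _ => x h _; apply: cvg_EFin => //; near=> n.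
- exact: iT.
- by apply: aeW cvgU _ => x _ n _ /=; exact: UT.
by exists u.
Unshelve. all: by end_near. Qed.

(** Picard iteration from 0 in L^1, where [vop B] has norm at most 1/2. *)
Lemma contraction_exists (bet : R -> R) B f : rel_kernel bet B ->
  (\int[mu]_t (bet t)%:E <= (2^-1)%:E)%E -> mu.-integrable setT (EFin \o f) ->
  exists2 u, mu.-integrable setT (EFin \o u) & {ae mu, forall x, u x + vop B u x = f x}.
Proof.
move=> kB b2 fi.
pose U := fix U n := if n is m.+1 then f \- vop B (U m) else (fun=> 0).
have iU n : mu.-integrable setT (EFin \o U n).
  elim: n => [|n ih]; first exact: integrable0.
  by have := integrableB measurableT fi (vop_integrable kB ih).
pose c := fine (\int[mu]_x `|f x|%:E).
have fc : (\int[mu]_x `|f x|%:E = c%:E)%E.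
  by rewrite fineK//; apply: integrable_fin_num => //; exact: (integrable_abse fi).
have c0 : 0 <= c by apply: fine_ge0; exact: integral_ge0.
have bnd v : mu.-integrable setT (EFin \o v) ->
    (\int[mu]_x `|vop B v x|%:E <= (2^-1)%:E * \int[mu]_x `|v x|%:E)%E.
  move=> iv; apply: le_trans (vop_L1_le kB iv) _.
  by apply: lee_wpmul2r => //; exact: integral_ge0.
have iB v : mu.-integrable setT (EFin \o v) -> mu.-integrable setT (EFin \o vop B v).
  exact: (vop_integrable kB).
have msub v w : mu.-integrable setT (EFin \o v) -> mu.-integrable setT (EFin \o w) ->
    measurable_fun setT (fun x => `|v x - w x|%:E).
  move=> iv iw; apply/measurable_EFinP; apply: measurableT_comp => //.
  by apply: measurable_funB; exact: L1_measurable.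
have isub v w : mu.-integrable setT (EFin \o v) -> mu.-integrable setT (EFin \o w) ->
    mu.-integrable setT (EFin \o (v \- w)).
  by move=> iv iw; have := integrableB measurableT iv iw.
have vdiff v w : mu.-integrable setT (EFin \o v) -> mu.-integrable setT (EFin \o w) ->
    (\int[mu]_x `|vop B v x - vop B w x|%:E <= (2^-1)%:E * \int[mu]_x `|v x - w x|%:E)%E.
  move=> iv iw; apply: le_trans (bnd _ (isub _ _ iv iw)).
  rewrite (@ae_eq_int _ _ (fun x => `|vop B (v \- w) x|%:E))//.
  - exact: msub (iB _ iv) (iB _ iw).
  - apply/measurable_EFinP; apply: measurableT_comp => //.
    exact: L1_measurable (iB _ (isub _ _ iv iw)).
  - by apply: aeW (vopB kB iv iw) _ => x ->.
(* The first increment is f, of norm c; the factor 2 lets c read 2c/2^1. *)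
have dU n : (\int[mu]_x `|U n.+1 x - U n x|%:E <= (c * 2 / (2 ^ n.+1)%:R)%:E)%E.
  elim: n => [|n ih].
    rewrite (@eq_int _ _ (fun x => `|f x|%:E)); last first.
      move=> x; rewrite /= subr0 (_ : vop B _ x = 0) ?subr0//.
      by rewrite /vop /Rintegral (@eq_int _ _ (fun=> 0%E)) ?integral0// => s; rewrite mulr0.
    by rewrite fc expn1 mulfK.
  rewrite (@eq_int _ _ (fun x => `|vop B (U n.+1) x - vop B (U n) x|%:E)); last first.
    by move=> x; rewrite /= distrC; congr (`|_|%:E); ring.
  apply: le_trans (vdiff _ _ (iU n.+1) (iU n)) _.
  apply: (@le_trans _ _ ((2^-1)%:E * (c * 2 / (2 ^ n.+1)%:R)%:E)%E).
    by apply: lee_wpmul2l => //; rewrite lee_fin.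
  by rewrite -EFinM lee_fin mulrCA -invfM -natrM -expnS.
have [|u iu cvU] := L1_complete _ (fun=> erefl) iU dU; first by rewrite mulr_ge0.
exists u => //.
pose r x := u x + vop B u x - f x.
have ir : mu.-integrable setT (EFin \o r).
  have := integrableB measurableT (integrableD measurableT iu (iB _ iu)) fi.
  by apply: eq_integrable.
have r0 : (\int[mu]_x `|r x|%:E = 0)%E.
  apply/eqP; rewrite eq_le integral_ge0// andbT.
  (* Since f is the sum of the iterate n+1 and of [vop B] at the iterate n, the residual is a sum of
     two differences, each controlled by the distance of an iterate to u. *)
  have h n : (\int[mu]_x `|r x|%:E <= \int[mu]_x `|U n.+1 x - u x|%:E + \int[mu]_x `|U n x - u x|%:E)%E.
    apply: (@le_trans _ _ (\int[mu]_x `|U n.+1 x - u x|%:E + \int[mu]_x `|vop B (U n) x - vop B u x|%:E)%E).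
      rewrite -ge0_integralD//; [|exact: msub|exact: msub (iB _ (iU n)) (iB _ iu)].
      apply: ge0_le_int => //.
      - by apply/measurable_EFinP/measurableT_comp => //; exact: L1_measurable ir.
      - by apply: emeasurable_funD; [exact: msub|exact: msub (iB _ (iU n)) (iB _ iu)].
      move=> x; rewrite -EFinD lee_fin -(normrN (U n.+1 x - u x)) -(normrN (vop B (U n) x - _)).
      by apply: le_trans (ler_normD _ _); rewrite /r/= le_eqVlt; apply/orP; left; apply/eqP; congr (`|_|); ring.
    apply: leeD => //; apply: le_trans (vdiff _ _ (iU n) iu) _.
    rewrite -[leRHS]mul1e; apply: lee_wpmul2r; first exact: integral_ge0.
    by rewrite lee_fin invf_le1// ler1n.
  have cv : ((\int[mu]_x `|U n.+1 x - u x|%:E + \int[mu]_x `|U n x - u x|%:E)%E @[n --> \oo] --> 0%E).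
    rewrite -[X in _ --> X]adde0; apply: cvgeD => //.
    by move: cvU; rewrite -(cvg_shiftS (fun n => (\int[mu]_x `|U n x - u x|%:E)%E)).
  by rewrite -(cvg_lim _ cv)//; apply: lime_ge; [apply/cvg_ex; exists 0%E|near=> n; exact: h].
have mr : measurable_fun setT (EFin \o r) by case/integrableP: ir.
have := (ae_eq_integral_abs mu measurableT mr).1 r0.
by move=> ae; apply: aeW ae _ => x /(_ I) /= [] /eqP; rewrite subr_eq0 => /eqP.
Unshelve. all: by end_near. Qed.

Lemma contraction_unique (bet : R -> R) B u : rel_kernel bet B ->
  (\int[mu]_t (bet t)%:E <= (2^-1)%:E)%E -> mu.-integrable setT (EFin \o u) ->
  {ae mu, forall x, u x + vop B u x = 0} -> {ae mu, forall x, u x = 0}.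
Proof.
move=> kB b2 iu e.
have mu_ := L1_measurable iu.
have u0 : (\int[mu]_x `|u x|%:E = 0)%E.
  have h : (\int[mu]_x `|u x|%:E <= (2^-1)%:E * \int[mu]_x `|u x|%:E)%E.
    rewrite [leLHS](@ae_eq_int _ _ (fun x => `|vop B u x|%:E)).
    - apply: le_trans (vop_L1_le kB iu) _.
      by apply: lee_wpmul2r => //; exact: integral_ge0.
    - by apply/measurable_EFinP/measurableT_comp.
    - by apply/measurable_EFinP/measurableT_comp => //; exact: L1_measurable (vop_integrable kB iu).
    - by apply: aeW e _ => x /eqP; rewrite addr_eq0 => /eqP ->; rewrite normrN.
  have fu : (\int[mu]_x `|u x|%:E)%E \is a fin_num.
    by apply: integrable_fin_num => //; exact: (integrable_abse iu).
  move: h; rewrite -(fineK fu) -EFinM lee_fin => h; congr EFin.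
  have : 0 <= fine (\int[mu]_x `|u x|%:E)%E by apply: fine_ge0; exact: integral_ge0.
  by move: h; lra.
have mr : measurable_fun setT (EFin \o u) by case/integrableP: iu.
have := (ae_eq_integral_abs mu measurableT mr).1 u0.
by move=> ae; apply: aeW ae _ => x /(_ I) /= [].
Qed.

(** Dominated convergence with [gam] itself as bound. As [gam] vanishes for t <= 0, the weight
    exp(-nt) counts only where it is at most 1 and tends to 0. *)
Lemma exp_weight_small (gam : R -> R) (c : R) : mu.-integrable setT (EFin \o gam) ->
  (forall t, 0 <= gam t) -> (forall t, t <= 0 -> gam t = 0) -> 0 < c ->
  exists n : nat, (\int[mu]_t (expR (- (n%:R * t)) * gam t)%:E <= c%:E)%E.
Proof.
move=> ig g0 gneg c0; have mg := L1_measurable ig.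
have [|||||_ _ cv] := @dominated_convergence _ _ _ mu setT measurableT
   (fun n t => (expR (- (n%:R * t)) * gam t)%:E) (fun=> 0%E) (EFin \o gam).
- move=> n; apply/measurable_EFinP; apply: measurable_funM => //.
  by apply: measurableT_comp => //; apply: measurableT_comp => //; exact: measurable_funM.
- exact: measurable_cst.
- apply: aeW (integrable_ae measurableT ig) _ => t _ _.
  apply: cvg_EFin; first by near=> n.
  have [t0|t0] := leP t 0.
    rewrite (_ : _ \o _ = (fun=> 0)); first exact: cvg_cst.
    by apply/funext => n; rewrite /= gneg// mulr0.
  rewrite (_ : _ \o _ = (fun n => geometric (gam t) (expR (- t)) n)).
    by apply: cvg_geometric; rewrite ger0_norm ?expR_ge0// expR_lt1 oppr_lt0.
  by apply/funext => n; rewrite /= mulrC -expRM_natl mulrN.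
- by [].
- apply: aeW (integrable_ae measurableT ig) _ => t _ n _ /=; rewrite lee_fin.
  rewrite normrM !ger0_norm ?expR_ge0//.
  have [t0|t0] := leP t 0; first by rewrite gneg// mulr0.
  by rewrite ler_piMl// expR_le1 oppr_le0 mulr_ge0// ltW.
rewrite integral0 in cv.
have /fine_cvgP[fn /cvgrPdist_le /(_ _ c0) h] := cv.
have : \forall n \near \oo, (\int[mu]_t (expR (- (n%:R * t)) * gam t)%:E <= c%:E)%E.
  near=> n; have hn : (\int[mu]_t (expR (- (n%:R * t)) * gam t)%:E)%E \is a fin_num by near: n.
  rewrite -(fineK hn) lee_fin; apply: le_trans (ler_norm _) _.
  by rewrite -normrN -sub0r; near: n.
by move=> [n _ hn]; exists n; apply: hn => /=.
Unshelve. all: by end_near. Qed.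

(** * The second-kind equation with coefficient bounded away from zero *)

Section volterra_second_kind.
Variables (b nu : R) (g0 gam : R -> R) (H : R -> R -> R).
Hypothesis nu0 : 0 < nu.
Hypothesis mg0 : measurable_fun setT g0.
Hypothesis g0nu : forall s, nu <= `|g0 s|.
Hypothesis kH : rel_kernel gam H.
Hypothesis gneg : forall t, t <= 0 -> gam t = 0.

Let D := `]0, b[%classic : set R.

Let mD1 : measurable_fun setT (\1_D : R -> R).
Proof. by apply: measurable_indic; exact: measurable_itv. Qed.

(* The equation for [expR (- n t) u] after division by [g0]; multiplying by the
   indicator at [s + t], the end point of the relative kernel, confines it to
   [`]0, b[]. *)
Let B (n : nat) s t := \1_D (s + t) * (g0 (s + t))^-1 * (expR (- (n%:R * t)) * H s t).

Let kB n : rel_kernel (fun t => nu^-1 * (expR (- (n%:R * t)) * gam t)) (B n).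
Proof.
have [mH igam Hle] := kH; have mgam := L1_measurable igam.
have mexp : measurable_fun setT (fun t : R => expR (- (n%:R * t))).
  by apply: measurableT_comp => //; apply: measurableT_comp => //; exact: measurable_funM.
have msum : measurable_fun setT (fun p : R * R => p.1 + p.2) by exact: measurable_funD.
split.
- apply: measurable_funM; last by apply: measurable_funM => //; exact: (measurableT_comp mexp).
  apply: measurable_funM; first exact: (measurableT_comp mD1 msum).
  apply: (measurableT_comp (f := fun x => (g0 x)^-1)) msum.
  exact: (measurable_funV mg0).
- have i1 : mu.-integrable setT (EFin \o (fun t => expR (- (n%:R * t)) * gam t)).
    apply: L1_le igam; first exact: measurable_funM.
    move=> t; have g0' := rel_kernel_ge0 t kH; rewrite normrM !ger0_norm ?expR_ge0//.
    have [t0|t0] := leP t 0; first by rewrite gneg// mulr0.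
    by rewrite ler_piMl// expR_le1 oppr_le0 mulr_ge0// ltW.
  by have := integrableZl measurableT nu^-1 i1; apply: eq_integrable.
- move=> s t; rewrite !normrM (@ger0_norm _ (expR _)) ?expR_ge0//.
  apply: ler_pM; rewrite ?mulr_ge0 ?expR_ge0//.
    rewrite -[leRHS]mul1r; apply: ler_pM => //.
      by rewrite indicE; case: (_ \in _); rewrite ?normr1 ?normr0.
    rewrite normfV lef_pV2 ?posrE// (lt_le_trans nu0)//.
  by rewrite ler_wpM2l ?expR_ge0.
Qed.

Let B_small : exists n : nat, (\int[mu]_t (nu^-1 * (expR (- (n%:R * t)) * gam t))%:E <= (2^-1)%:E)%E.
Proof.
have [mH igam Hle] := kH; have mgam := L1_measurable igam.
have [|n hn] := @exp_weight_small gam (nu / 2) igam (fun t => rel_kernel_ge0 t kH) gneg.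
  by rewrite divr_gt0.
exists n; under eq_integral do rewrite EFinM.
rewrite ge0_integralZl//; last 3 first.
- apply/measurable_EFinP; apply: measurable_funM => //.
  by apply: measurableT_comp => //; apply: measurableT_comp => //; exact: measurable_funM.
- by move=> t _; rewrite lee_fin mulr_ge0 ?expR_ge0// (rel_kernel_ge0 t kH).
- by rewrite lee_fin invr_ge0 ltW.
apply: le_trans (lee_wpmul2l _ hn) _; first by rewrite lee_fin invr_ge0 ltW.
by rewrite -EFinM lee_fin mulrA mulVf ?gt_eqF// mul1r.
Qed.

(** The weight is multiplicative, exp(-n(x-s)) = exp(-nx) exp(ns), so [B n] is [H] conjugated by the
    exponential, divided by [g0] and cut off to []0, b[]. *)
Let BE n u w : (forall x, u x = expR (n%:R * x) * w x) ->
  mu.-integrable setT (EFin \o u) ->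
  {ae mu, forall x, vop (B n) w x = \1_D x * (expR (- (n%:R * x)) / g0 x) * vop H u x}.
Proof.
move=> uw iu; apply: aeW (ae_integrable_vop kH iu) _ => x ix.
rewrite /vop -RintegralZl//; apply: eq_Rintegral => s _.
rewrite /B subrKC uw (_ : - (n%:R * (x - s)) = - (n%:R * x) + n%:R * s); last by ring.
by rewrite expRD; ring.
Qed.

Lemma volterra2_exists f : mu.-integrable setT (EFin \o f) ->
  exists u, [/\ mu.-integrable setT (EFin \o u), forall x, x \notin `]0, b[ -> u x = 0 &
    ae_on 0 b (fun x => g0 x * u x + vop H u x = f x)].
Proof.
move=> fi; have mf := L1_measurable fi; have [n hn] := B_small.
have mexp : measurable_fun setT (fun t : R => expR (- (n%:R * t))).
  by apply: measurableT_comp => //; apply: measurableT_comp => //; exact: measurable_funM.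
have mexp' : measurable_fun setT (fun t : R => expR (n%:R * t)).
  by apply: measurableT_comp => //; exact: measurable_funM.
have D1 x : \1_D x = (x \in `]0, b[)%:R :> R by rewrite indicE mem_setE.
pose F x := \1_D x * (expR (- (n%:R * x)) / g0 x) * f x.
have iF : mu.-integrable setT (EFin \o F).
  apply: (@L1_le _ _ (fun x => nu^-1 * `|f x|)).
  - apply: measurable_funM => //; apply: measurable_funM; first exact: mD1.
    by apply: measurable_funM => //; exact: measurable_funV.
  - move=> x; rewrite /F normrM ler_wpM2r// D1.
    have [xD|_] := boolP (x \in `]0, b[); last by rewrite mul0r normr0 invr_ge0 ltW.
    move: xD; rewrite in_itv/= mul1r => /andP[x0 _]; rewrite normrM normfV ger0_norm ?expR_ge0//.
    rewrite -[leRHS]mul1r; apply: ler_pM; rewrite ?expR_ge0 ?invr_ge0//.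
      by rewrite expR_le1 oppr_le0 mulr_ge0// ltW.
    by rewrite lef_pV2 ?posrE// (lt_le_trans nu0).
  - by have := integrableZl measurableT nu^-1 (integrable_norm fi).
have [w iw hw] := contraction_exists (kB n) hn iF.
have mw := L1_measurable iw.
(* Off []0, b[] both the operator and the right-hand side vanish, so the fixed point is zero almost
   everywhere there. [w'] is the version that is zero everywhere there, which also keeps exp(nx)
   bounded on its support. *)
pose w' x := \1_D x * w x.
have iw' : mu.-integrable setT (EFin \o w').
  apply: L1_le (integrable_norm iw); first exact: measurable_funM.
  move=> x /=; rewrite /w' normrM ler_piMl// D1.
  by case: (_ \in _); rewrite ?normr1 ?normr0.
have B0 v x : x \notin `]0, b[ -> vop (B n) v x = 0.
  move=> xD; rewrite /vop /Rintegral (@eq_int _ _ (fun=> 0%E)) ?integral0// => s.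
  by rewrite /B subrKC D1 (negbTE xD) !mul0r.
have ww' : {ae mu, forall x, w x = w' x}.
  apply: aeW hw _ => x hx; rewrite /w' D1.
  have [xD|xD] := boolP (x \in `]0, b[); first by rewrite mul1r.
  by move: hx; rewrite B0// addr0 /F D1 (negbTE xD) !mul0r.
pose u x := expR (n%:R * x) * w' x.
have iu : mu.-integrable setT (EFin \o u).
  apply: (@L1_le _ _ (fun x => expR (n%:R * b) * `|w' x|)).
  - by apply: measurable_funM => //; exact: L1_measurable iw'.
  - move=> x; rewrite /u normrM ger0_norm ?expR_ge0// /w' D1.
    have [xD|_] := boolP (x \in `]0, b[); last by rewrite mul0r normr0 !mulr0.
    rewrite ler_wpM2r// ler_expR ler_wpM2l//.
    by move: xD; rewrite in_itv/= => /andP[_ /ltW].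
  - by have := integrableZl measurableT (expR (n%:R * b)) (integrable_norm iw').
exists u; split => //.
  by move=> x xD; rewrite /u /w' D1 (negbTE xD) mul0r mulr0.
have e := eq_ae_vop (kB n) iw iw' ww'.
apply: aeW3 (BE (fun x => erefl (u x)) iu) hw ww' _ => x h1 h2 h3 xD.
have g00 : g0 x != 0 by rewrite -normr_gt0 (lt_le_trans nu0).
move: h2; rewrite h3 e h1 /F D1 xD !mul1r.
rewrite expRN -/(u x) => h2.
have ex0 : expR (n%:R * x) != 0 by rewrite gt_eqF// expR_gt0.
rewrite /u; apply: (mulfI (mulf_neq0 (invr_neq0 ex0) (invr_neq0 g00))).
by rewrite -h2; field; rewrite ex0 g00.
Qed.

Lemma volterra2_unique u : mu.-integrable setT (EFin \o u) ->
  (forall x, x \notin `]0, b[ -> u x = 0) ->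
  ae_on 0 b (fun x => g0 x * u x + vop H u x = 0) -> {ae mu, forall x, u x = 0}.
Proof.
move=> iu u0 hu; have mu_ := L1_measurable iu; have [n hn] := B_small.
have D1 x : \1_D x = (x \in `]0, b[)%:R :> R by rewrite indicE mem_setE.
pose w x := expR (- (n%:R * x)) * u x.
have uw x : u x = expR (n%:R * x) * w x.
  by rewrite /w mulrA -expRD subrr expR0 mul1r.
have iw : mu.-integrable setT (EFin \o w).
  apply: L1_le (integrable_norm iu).
    apply: measurable_funM => //.
    by apply: measurableT_comp => //; apply: measurableT_comp => //; exact: measurable_funM.
  move=> x; rewrite /w normrM ger0_norm ?expR_ge0//=.
  have [xD|/u0 ->] := boolP (x \in `]0, b[); last by rewrite normr0 mulr0.
  rewrite ler_piMl// expR_le1 oppr_le0 mulr_ge0//.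
  by move: xD; rewrite in_itv/= => /andP[/ltW].
have w0 : {ae mu, forall x, w x = 0}.
  apply: (contraction_unique (kB n) hn iw).
  apply: aeW2 (BE uw iu) hu _ => x -> hx; rewrite D1.
  have [xD|xD] := boolP (x \in `]0, b[); last by rewrite !mul0r addr0 /w u0// mulr0.
  have g00 : g0 x != 0 by rewrite -normr_gt0 (lt_le_trans nu0).
  rewrite mul1r /w (_ : vop H u x = - (g0 x * u x)); last first.
    by apply/eqP; rewrite -addr_eq0 addrC hx.
  by field.
by apply: aeW w0 _ => x wx; rewrite uw wx mulr0.
Qed.

End volterra_second_kind.

End volterra2.

(** * Smooth bumps and the primitive of a Sobolev function *)

Section smooth.
Context {R : realType}.
Implicit Types (f g : R -> R) (x : R).

(** Differentiability n+1 times, so the index is shifted by one from the usual convention. Keeping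
    the derivative as a witness makes closure under sums and products a plain induction. *)
Fixpoint Ck (n : nat) (f : R -> R) : Prop :=
  exists2 df : R -> R, (forall x, is_derive x 1 f (df x)) & if n is m.+1 then Ck m df else True.

Lemma CkW n f : Ck n.+1 f -> Ck n f.
Proof.
elim: n f => [|n ih] f [df fdf Cdf]; first by exists df.
by exists df => //; exact: ih.
Qed.

Lemma Ck_smooth f : (forall n, Ck n f) -> forall n x, derivable (derive1n n f) x 1.
Proof.
move=> + n; elim: n f => [|n ih] f Cf x; first by have [df h _] := Cf 0%N; have [] := h x.
rewrite derive1Sn; apply: ih => m; have [df h Cdf] := Cf m.+1.
rewrite (_ : derive1 f = df)//; apply/funext => y; rewrite derive1E.
by have [] := h y.
Qed.

Lemma CkD n f g : Ck n f -> Ck n g -> Ck n (fun x => f x + g x).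
Proof.
elim: n f g => [|n ih] f g [df hf Cf] [dg hg Cg].
  by exists (fun x => df x + dg x) => // x; exact: is_deriveD.
by exists (fun x => df x + dg x); [move=> x; exact: is_deriveD|exact: ih].
Qed.

Lemma Ck_cst n (c : R) : Ck n (fun=> c).
Proof.
by elim: n c => [|n ih] c; exists (fun=> 0) => // x; exact: is_derive_cst.
Qed.

Lemma CkM n f g : Ck n f -> Ck n g -> Ck n (fun x => f x * g x).
Proof.
elim: n f g => [|n ih] f g.
  move=> [df hf _] [dg hg _]; exists (fun x => f x * dg x + g x * df x) => // x.
  exact: is_deriveM.
move=> Cf Cg; have := CkW Cf; have := CkW Cg; case: Cf Cg => [df hf Cf] [dg hg Cg] Cg' Cf'.
exists (fun x => f x * dg x + g x * df x); first by move=> x; exact: is_deriveM.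
by apply: CkD; exact: ih.
Qed.

Lemma Ck_affine n f (c d : R) : Ck n f -> Ck n (fun x => f (c * x + d)).
Proof.
have aff x : is_derive x 1 (fun y : R => c * y + d) c.
  have h : is_derive x 1 (fun y : R => c *: y + d) (c *: 1 + 0) by exact: is_deriveD.
  by apply: is_derive_eq h _; rewrite addr0 /GRing.scale/= mulr1.
elim: n f => [|n ih] f [df hf Cf]; exists (fun x => df (c * x + d) * c) => //.
- by move=> x; apply: is_derive1_comp.
- by move=> x; apply: is_derive1_comp.
- by apply: CkM; [exact: ih|exact: Ck_cst].
Qed.

(* The negative powers make the family closed under derivation. *)
Definition bump (a : R) (k : nat) (x : R) : R := if 0 < x then x ^- k * expR (- (a / x)) else 0.

(** The inequality e^y >= y at y = a/(x(k+2)), raised to the power k+2, beats x^-k with the margin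
    x^2. That margin makes the derivative at 0 exist and vanish. *)
Lemma bump_le a k x : 0 < a -> `|bump a k x| <= (k.+2%:R / a) ^+ k.+2 * x ^+ 2.
Proof.
move=> a0; rewrite /bump; case: ltP => x0; last first.
  by rewrite normr0 mulr_ge0 ?sqr_ge0// exprn_ge0// divr_ge0// ltW.
rewrite ger0_norm ?mulr_ge0 ?expR_ge0 ?invr_ge0 ?exprn_ge0 ?(ltW x0)//.
pose N : R := k.+2%:R; have N0 : 0 < N by [].
have h : (a / (x * N)) ^+ k.+2 <= expR (a / x).
  rewrite (_ : a / x = k.+2%:R * (a / (x * N))); last by rewrite -/N; field; rewrite !gt_eqF.
  rewrite expRM_natl lerXn2r ?nnegrE ?expR_ge0 ?divr_ge0 ?mulr_ge0 ?ltW//.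
  by apply: lt_le_trans (expR_ge1Dx _); rewrite ltrDr.
have p0 : 0 < (a / (x * N)) ^+ k.+2 by rewrite exprn_gt0// divr_gt0// mulr_gt0.
have h' : expR (- (a / x)) <= ((a / (x * N)) ^+ k.+2)^-1.
  by rewrite expRN lef_pV2// posrE ?expR_gt0.
apply: (@le_trans _ _ (x ^- k * ((a / (x * N)) ^+ k.+2)^-1)).
  by rewrite ler_wpM2l// invr_ge0 exprn_ge0// ltW.
rewrite -(exprVn (a / (x * N))) (_ : (a / (x * N))^-1 = (N / a) * x); last by field; rewrite !gt_eqF.
rewrite exprMn mulrCA -/N; apply: ler_wpM2l; first by rewrite exprn_ge0// divr_ge0// ltW.
by rewrite -(addn2 k) exprD mulrA mulVf ?mul1r ?expf_neq0 ?gt_eqF.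
Qed.

Lemma is_derive_bump a k x : 0 < a ->
  is_derive x 1 (bump a k) (a * bump a k.+2 x + - k%:R * bump a k.+1 x).
Proof.
move=> a0; have [x0|x0|->] := ltgtP x 0.
- have b0 j y : y < 0 -> bump a j y = 0 by move=> y0; rewrite /bump ltNge ltW.
  rewrite !b0// !mulr0 addr0.
  apply: (@near_eq_is_derive R R R (cst 0) _ x 1 0).
  near=> y; rewrite b0//.
  by near: y; exact: lt_nbhsl.
(* For x > 0 the power x^-k is written exp(-k ln x), so that a single exponential is
   differentiated. *)
- have h1 : is_derive x 1 (fun y : R => expR (- (a *: y^-1) + - (k%:R *: ln y)))
     (expR (- (a *: x^-1) + - (k%:R *: ln x)) * (- (a *: (- x ^- 2 *: 1)) + - (k%:R *: x^-1))).
    apply: (@is_derive1_comp _ expR).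
    apply: is_deriveD; apply: is_deriveN; apply: is_deriveZ.
      by apply: is_deriveV; rewrite gt_eqF.
    exact: is_derive1_ln.
  have e (y : R) : 0 < y -> expR (- (a *: y^-1) + - (k%:R *: ln y)) = bump a k y.
    move=> y0; rewrite /bump y0 expRD mulrC; congr (_ * _).
    by rewrite /GRing.scale/= expRN expRM_natl lnK.
  apply: (near_eq_is_derive _ (is_derive_eq h1 _)).
    near=> y; apply: e; near: y; exact: lt_nbhsr.
  rewrite e// /bump x0 !exprS /GRing.scale/=; field.
  by rewrite expf_neq0 gt_eqF.
- have b0 j : bump a j 0 = 0 by rewrite /bump ltxx.
  rewrite !b0 !mulr0 addr0.
  pose C := (k.+2%:R / a) ^+ k.+2; have C0 : 0 < C by rewrite exprn_gt0// divr_gt0.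
  have cv : (fun h => h^-1 *: (bump a k (h *: 1 + 0) - bump a k 0)) @ 0^' --> (0 : R).
    apply/cvgrPdist_le => e e0; rewrite near_withinE.
    have nb : \forall h \near (0 : R), `|h| <= C^-1 * e.
      by apply: nbhs0_le; rewrite mulr_gt0// invr_gt0.
    near=> h => h0; rewrite addr0 /GRing.scale/= mulr1 b0 subr0 sub0r normrN normrM.
    rewrite normfV ler_pdivrMl ?normr_gt0//.
    apply: le_trans (bump_le _ _ a0) _; rewrite -/C.
    rewrite -real_normK ?num_real// expr2 mulrA [leRHS]mulrC.
    rewrite ler_pM2r ?normr_gt0// -ler_pdivlMl//.
    by near: h; exact: nb.
  apply: DeriveDef; first by apply/cvg_ex; exists 0; exact: cv.
  exact: cvg_lim cv.
Unshelve. all: by end_near. Qed.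

Lemma Ck_bump n a k : 0 < a -> Ck n (bump a k).
Proof.
move=> a0; elim: n k => [|n ih] k; exists (fun x => a * bump a k.+2 x + - k%:R * bump a k.+1 x) => //.
- by move=> x; exact: is_derive_bump.
- by move=> x; exact: is_derive_bump.
by apply: CkD; apply: CkM => //; exact: Ck_cst.
Qed.

End smooth.

(** * Weak derivatives and the representation by a primitive *)

Section w11.
Context {R : realType}.
Notation mu := (@lebesgue_measure R).
Implicit Types (f g h : R -> R) (x : R).

(** A smooth function that is zero off []al, be[], with values in [0, 1]; as [a] tends to 0 it
    converges to the indicator of that interval. *)
Definition bump2 (a al be : R) (x : R) : R := bump a 0 (x - al) * bump a 0 (be - x).

Lemma Ck_bump2 n (a al be : R) : 0 < a -> Ck n (bump2 a al be).
Proof.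
move=> a0; apply: CkM.
  have := @Ck_affine R n (bump a 0) 1 (- al) (Ck_bump n 0 a0).
  by rewrite (_ : (fun x => _) = (fun x => bump a 0 (x - al)))//; apply/funext => x; rewrite mul1r.
have := @Ck_affine R n (bump a 0) (-1) be (Ck_bump n 0 a0).
by rewrite (_ : (fun x => _) = (fun x => bump a 0 (be - x)))//; apply/funext => x; rewrite mulN1r addrC.
Qed.

Lemma bump0_01 (a x : R) : 0 < a -> 0 <= bump a 0 x <= 1.
Proof.
move=> a0; rewrite /bump; case: ifP => x0; last by rewrite lexx ler01.
by rewrite expr0 invr1 mul1r expR_ge0 expR_le1 oppr_le0 divr_ge0// ltW.
Qed.

Lemma bump2_01 (a al be x : R) : 0 < a -> 0 <= bump2 a al be x <= 1.
Proof.
move=> a0; have /andP[h1 h2] := bump0_01 (x - al) a0; have /andP[h3 h4] := bump0_01 (be - x) a0.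
by rewrite mulr_ge0//= mulr_ile1.
Qed.

Lemma bump2_out (a al be x : R) : x \notin `]al, be[ -> bump2 a al be x = 0.
Proof.
rewrite in_itv/= negb_and -!leNgt /bump2 /bump !subr_gt0 => /orP[xa|bx].
  by rewrite ltNge xa mul0r.
by rewrite [X in _ * X]ifF ?mulr0//; apply/negbTE; rewrite -leNgt.
Qed.

Lemma bump2_continuous (a al be : R) : 0 < a -> continuous (bump2 a al be).
Proof.
move=> a0 x; have [df hd _] := Ck_bump2 0 al be a0.
apply: differentiable_continuous; apply/derivable1_diffP.
by have [] := hd x.
Qed.

Lemma integrable_bump2 (a al be : R) : 0 < a -> mu.-integrable setT (EFin \o bump2 a al be).
Proof.
move=> a0; apply: (@L1_le _ _ (\1_`]al, be[)).
- by apply: continuous_measurable_fun; exact: bump2_continuous.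
- move=> x; have /andP[h1 h2] := bump2_01 al be x a0.
  rewrite ger0_norm// indicE mem_setE.
  by have [//|/bump2_out ->] := boolP (x \in `]al, be[).
- exact: integrable_indic_itv.
Qed.

Lemma primitive_bump2_derive (a al be x : R) : 0 < a ->
  is_derive x 1 (primitive (bump2 a al be)) (bump2 a al be x).
Proof.
move=> a0; have [||||h1 h2] := @continuous_FTC1 R (bump2 a al be) -oo%O x (x + 1).
- by rewrite ltrDl.
- by apply: integrableS (integrable_bump2 al be a0).
- by rewrite ltNyr.
- exact: bump2_continuous.
by apply: DeriveDef; [exact: h1|rewrite -derive1E].
Qed.

Lemma primitive_left f al x : (forall t, t <= al -> f t = 0) -> x <= al -> primitive f x = 0.
Proof.
move=> f0 xal; rewrite /primitive Rintegral_mkcond /Rintegral (@eq_int _ _ (fun=> 0%E)) ?integral0// => t.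
rewrite patchE mem_setE in_itv/=; case: ifP => // tx; rewrite f0//.
exact: le_trans tx _.
Qed.

Lemma primitive_right f be x : (forall t, be <= t -> f t = 0) -> be <= x ->
  primitive f x = \int[mu]_t f t.
Proof.
move=> f0 bx; rewrite /primitive Rintegral_mkcond; congr fine; apply: eq_int => t.
rewrite patchE mem_setE in_itv/=; case: leP => // xt; rewrite f0//.
by rewrite (le_trans bx)// ltW.
Qed.

Lemma primitive_norm_le f x : mu.-integrable setT (EFin \o f) ->
  `|primitive f x| <= \int[mu]_t `|f t|.
Proof.
move=> fi; rewrite /primitive; apply: (@le_trans _ _ (\int[mu]_(t in `]-oo, x]) `|f t|)).
  by apply: le_normr_Rintegral => //; exact: integrableS fi.
have fi' := integrable_norm fi.
apply: fine_le; [apply: integrable_fin_num => //; exact: integrableS fi'|exact: integrable_fin_num|].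
apply: ge0_subset_integral => //.
by apply/measurable_EFinP; exact: L1_measurable fi'.
Qed.

Lemma measurable_primitive f : mu.-integrable setT (EFin \o f) -> measurable_fun setT (primitive f).
Proof.
move=> fi; have mf := L1_measurable fi.
rewrite (_ : primitive f = fun x => \int[mu]_y (if y <= x then f y else 0)); last first.
  apply/funext => x; rewrite /primitive Rintegral_mkcond; apply: eq_Rintegral => y _.
  by rewrite patchE mem_setE in_itv.
apply: measurableT_comp => //.
apply: (@measurable_integral1 R (fun p => (if p.2 <= p.1 then f p.2 else 0)%:E)).
apply/measurable_EFinP; apply: measurable_fun_ifT => //; first exact: measurable_fun_ler.
exact: measurableT_comp.
Qed.

(** Fubini on the half-plane y < x; the integral of [eta] over x > y is its total integral minus its
    primitive at y. *)
Lemma primitive_parts h eta : mu.-integrable setT (EFin \o h) -> mu.-integrable setT (EFin \o eta) ->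
  \int[mu]_x (primitive h x * eta x) = \int[mu]_y (h y * (\int[mu]_t eta t - primitive eta y)).
Proof.
move=> ih ie; have mh := L1_measurable ih; have me := L1_measurable ie.
pose F (p : R * R) : R := if p.2 < p.1 then h p.2 * eta p.1 else 0.
have mF : measurable_fun setT F.
  apply: measurable_fun_ifT => //; first exact: measurable_fun_ltr.
  by apply: measurable_funM; exact: measurableT_comp.
have iF : (mu \x mu)%E.-integrable setT (fun p => (F p)%:E).
  apply/integrable12ltyP; first exact/measurable_EFinP.
  apply: (@le_lt_trans _ _ (\int[mu]_x ((\int[mu]_y `|h y|%:E) * `|eta x|%:E))%E).
    apply: ge0_le_int => //.
    - apply: (@measurable_integral1 R (fun p => `|(F p)%:E|%E)).
      by apply: measurableT_comp => //; exact/measurable_EFinP.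
    - apply: emeasurable_funM => //; exact/measurable_EFinP/measurableT_comp.
    - by move=> x; apply: integral_ge0.
    move=> x; rewrite -ge0_integralZr//; last exact/measurable_EFinP/measurableT_comp.
    apply: ge0_le_int => //.
    - by apply: measurableT_comp => //; apply/measurable_EFinP; exact: (measurable_pair1 x mF).
    - by apply: emeasurable_funM => //; exact/measurable_EFinP/measurableT_comp.
    - move=> y; rewrite -EFinM lee_fin /F/=; case: ifP => _; first by rewrite normrM.
      by rewrite normr0 mulr_ge0.
  rewrite ge0_integralZl//; [|exact/measurable_EFinP/measurableT_comp|exact: integral_ge0].
  apply: lte_mul_pinfty; [exact: integral_ge0| |exact: integrable_norm_lty].
  by apply: integrable_fin_num => //; exact: (integrable_abse ih).
have pE x : primitive h x = \int[mu]_y (if y < x then h y else 0).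
  rewrite /primitive -Rintegral_itv_bndo_bndc; last exact: integrableS ih.
  by rewrite Rintegral_mkcond; apply: eq_Rintegral => y _; rewrite patchE mem_setE in_itv.
have ilt x : mu.-integrable setT (EFin \o (fun y : R => if y < x then h y else 0)).
  apply: L1_le (integrable_norm ih).
    by apply: measurable_fun_ifT => //; exact: measurable_fun_ltr.
  by move=> y /=; case: ifP; rewrite ?normr0.
have igt y : mu.-integrable setT (EFin \o (fun x : R => if y < x then eta x else 0)).
  apply: L1_le (integrable_norm ie).
    by apply: measurable_fun_ifT => //; exact: measurable_fun_ltr.
  by move=> x /=; case: ifP; rewrite ?normr0.
congr fine; transitivity (\int[mu]_x \int[mu]_y (F (x, y))%:E)%E.
  apply: eq_int => x; transitivity ((\int[mu]_y (if y < x then h y else 0)%:E) * (eta x)%:E)%E.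
    by rewrite pE EFinM; congr (_ * _)%E; apply: fineK; exact: integrable_fin_num (ilt x).
  rewrite -integralZr//; last exact: ilt.
  by apply: eq_int => y; rewrite /F/= -EFinM; case: ifP; rewrite ?mul0r.
rewrite (Fubini iF)/=; apply: eq_int => y.
rewrite (@eq_int _ _ (fun x => (h y)%:E * (if y < x then eta x else 0)%:E)%E); last first.
  by move=> x; rewrite /F/= -EFinM; case: ifP; rewrite ?mulr0.
rewrite integralZl//; last exact: igt.
rewrite EFinM; congr (_ * _)%E; apply: (etrans (esym (fineK (integrable_fin_num measurableT (igt y))))).
congr EFin; rewrite -/(Rintegral _ _ _) /primitive [in RHS]Rintegral_mkcond -RintegralB//; last first.
  by apply: L1_restrict => //; exact: integrableS ie.
apply: eq_Rintegral => x _; rewrite patchE mem_setE in_itv/= leNgt.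
by case: ifP => _ /=; rewrite ?subr0 ?subrr.
Qed.

Lemma bump2_cvg (p : R -> R) (al be : R) : mu.-integrable setT (EFin \o p) ->
  \int[mu]_x (p x * bump2 n.+1%:R^-1 al be x) @[n --> \oo] --> \int[mu]_(x in `]al, be[) p x.
Proof.
move=> ip; have mp := L1_measurable ip.
have mb n : measurable_fun setT (bump2 n.+1%:R^-1 al be).
  by apply: L1_measurable; apply: integrable_bump2; rewrite invr_gt0.
have mpb n : measurable_fun setT (fun x => p x * bump2 n.+1%:R^-1 al be x).
  exact: measurable_funM.
have mp1 : measurable_fun setT (fun x => p x * \1_`]al, be[ x).
  by apply: measurable_funM => //; apply: measurable_indic; exact: measurable_itv.
have cvb x : bump2 n.+1%:R^-1 al be x @[n --> \oo] --> (\1_`]al, be[ x : R).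
  rewrite indicE mem_setE; have [xab|/bump2_out xab] := boolP (x \in `]al, be[); last first.
    by rewrite (_ : (fun n => _) = (fun=> 0)); [exact: cvg_cst|apply/funext => n; rewrite xab].
  have cv1 (y : R) : 0 < y -> bump n.+1%:R^-1 0 y @[n --> \oo] --> (1 : R).
    move=> y0; rewrite (_ : (fun n => _) = (fun n => expR (- (n.+1%:R^-1 / y)))); last first.
      by apply/funext => n; rewrite /bump y0 expr0 invr1 mul1r.
    have h1 : n.+1%:R^-1 * y^-1 @[n --> \oo] --> (0 * y^-1 : R).
      by apply: cvgM; [exact: cvg_harmonic|exact: cvg_cst].
    have h2 : (fun n => - (n.+1%:R^-1 * y^-1)) @ \oo --> (0 : R).
      by rewrite -oppr0 -(mul0r y^-1); exact: cvgN.
    rewrite -[X in _ --> X](@expR0 R).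
    exact: (@cvg_comp _ _ _ (fun n => - (n.+1%:R^-1 * y^-1)) expR _ _ _ h2 (@continuous_expR R 0)).
  rewrite -[X in _ --> X](mul1r 1); apply: cvgM; apply: cv1.
    by move: xab; rewrite in_itv/= subr_gt0 => /andP[].
  by move: xab; rewrite in_itv/= subr_gt0 => /andP[].
have [|||||i _ cv] := @dominated_convergence _ _ _ mu setT measurableT
   (fun n x => (p x * bump2 n.+1%:R^-1 al be x)%:E) (EFin \o (fun x => p x * \1_`]al, be[ x)) (EFin \o (fun x => `|p x|)).
- by move=> n; apply/measurable_EFinP; exact: mpb.
- by apply/measurable_EFinP; exact: mp1.
- apply: aeW (integrable_ae measurableT ip) _ => x _ _; apply: cvg_EFin; first by near=> n.
  by apply: cvgM; [exact: cvg_cst|exact: cvb].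
- exact: (integrable_norm ip).
- apply: aeW (integrable_ae measurableT ip) _ => x _ n _ /=; rewrite lee_fin normrM.
  have a0 : 0 < n.+1%:R^-1 :> R by rewrite invr_gt0.
  by have /andP[h1 h2] := bump2_01 al be x a0; rewrite ler_piMr// ger0_norm.
have e : (\int[mu]_x (p x * \1_`]al, be[ x)%:E)%E = (\int[mu]_(x in `]al, be[) p x)%:E.
  rewrite Rintegral_mkcond fineK; last first.
    by apply: integrable_fin_num => //; apply: L1_restrict => //; exact: integrableS ip.
  apply: eq_int => x; rewrite patchE indicE; case: (_ \in _); by rewrite ?mulr1 ?mulr0.
by move: cv; rewrite /= e => /fine_cvgP[].
Unshelve. all: by end_near. Qed.

Lemma seq_cvg_eq (u v : nat -> R) (l m : R) : u =1 v ->
  u n @[n --> \oo] --> l -> v n @[n --> \oo] --> m -> l = m.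
Proof.
move=> /funext -> ul um.
by rewrite -(cvg_lim (@Rhausdorff R) ul) -(cvg_lim (@Rhausdorff R) um).
Qed.

(** The du Bois-Reymond argument. The difference p of f and the primitive of h integrates to zero
    against derivatives of test functions. Combinations of two bumps with zero total integral are
    such derivatives, so p has the same mean over any two intervals strictly inside []0, b[]; its
    primitive is affine and p is constant almost everywhere. *)
Lemma W11_primitive (b : R) f : 0 < b -> W11 0 b f ->
  exists c h, [/\ mu.-integrable setT (EFin \o h), (forall t, t <= 0 -> h t = 0) &
    ae_on 0 b (fun t => f t = c + primitive h t)].
Proof.
move=> b0 [if0 [h0 ih0 weak]].
have mD : measurable (`]0, b[%classic : set R) by exact: measurable_itv.
pose h := h0 \_ `]0, b[; have ih : mu.-integrable setT (EFin \o h) by exact: L1_restrict.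
pose f1 := f \_ `]0, b[; have if1 : mu.-integrable setT (EFin \o f1) by exact: L1_restrict.
have mf1 := L1_measurable if1; have mph := measurable_primitive ih.
pose p x := if x \in `]0, b[ then f1 x - primitive h x else 0.
have pE x : p x = f1 x - \1_`]0, b[ x * primitive h x.
  rewrite /p /f1 patchE indicE !mem_setE; have [xD|xD] := boolP (x \in `]0, b[).
    by rewrite mul1r.
  by rewrite mul0r subr0.
have ip : mu.-integrable setT (EFin \o p).
  have i2 : mu.-integrable setT (EFin \o (fun x => \1_`]0, b[ x * primitive h x)).
    apply: (@L1_le _ _ (fun x => (\int[mu]_t `|h t|) * \1_`]0, b[ x)).
    - by apply: measurable_funM => //; exact: measurable_indic.
    - move=> x; rewrite normrM indicE; case: (_ \in _); last by rewrite normr0 mul0r mulr0.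
      by rewrite normr1 mul1r mulr1; exact: primitive_norm_le.
    - by have := integrableZl measurableT (\int[mu]_t `|h t|) (integrable_indic_itv 0 b false true).
  have := integrableB measurableT if1 i2; apply: eq_integrable => // x _.
  by rewrite /= -EFinB pE.
have ib (al be : R) n : mu.-integrable setT (EFin \o bump2 n.+1%:R^-1 al be).
  by apply: integrable_bump2; rewrite invr_gt0.
have iM q (al be : R) n : mu.-integrable setT (EFin \o q) ->
    mu.-integrable setT (EFin \o (fun x => q x * bump2 n.+1%:R^-1 al be x)).
  move=> iq; apply: L1_le (integrable_norm iq).
    by apply: measurable_funM; [exact: L1_measurable iq|exact: L1_measurable (ib _ _ _)].
  have a0 : 0 < n.+1%:R^-1 :> R by rewrite invr_gt0.
  move=> x /=; have /andP[h1 h2] := bump2_01 al be x a0.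
  by rewrite normrM ler_piMr// ger0_norm.
have ortho n (al be ga de : R) : 0 < al -> al < be -> be < b -> 0 < ga -> ga < de -> de < b ->
    (\int[mu]_x bump2 n.+1%:R^-1 ga de x) * \int[mu]_x (p x * bump2 n.+1%:R^-1 al be x) =
    (\int[mu]_x bump2 n.+1%:R^-1 al be x) * \int[mu]_x (p x * bump2 n.+1%:R^-1 ga de x).
  move=> al0 albe beb ga0 gade deb.
  set e1 := bump2 _ al be; set e2 := bump2 _ ga de.
  set A := \int[mu]_x e1 x; set B := \int[mu]_x e2 x.
  have a0 : 0 < n.+1%:R^-1 :> R by rewrite invr_gt0.
  (* The coefficients give the combination of [e1] and [e2] total integral zero, so that [phi]
     vanishes also to the right of both supports. *)
  pose phi x := B * primitive e1 x + - A * primitive e2 x.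
  pose dphi x := B * e1 x + - A * e2 x.
  have hphi x : is_derive x 1 phi (dphi x).
    have d1 := primitive_bump2_derive al be x a0; have d2 := primitive_bump2_derive ga de x a0.
    have := is_deriveD (is_deriveZ B d1) (is_deriveZ (- A) d2).
    by [].
  have dphiE : derive1 phi = dphi.
    by apply/funext => x; rewrite derive1E; have [] := hphi x.
  pose lo := Num.min al ga; pose hi := Num.max be de.
  have phi_lo x : x <= lo -> phi x = 0.
    rewrite le_min => /andP[h1 h2]; rewrite /phi !(@primitive_left _ x) ?mulr0 ?addr0// => t tx.
      by rewrite /e2 bump2_out// in_itv/= ltNge (le_trans tx h2).
    by rewrite /e1 bump2_out// in_itv/= ltNge (le_trans tx h1).
  have phi_hi x : hi <= x -> phi x = 0.
    rewrite ge_max => /andP[h1 h2]; rewrite /phi !(@primitive_right _ x)//.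
    - by rewrite -/A -/B mulNr (mulrC B) subrr.
    - by move=> t tx; rewrite /e2 bump2_out// in_itv/= [X in _ && X]ltNge (le_trans h2 tx) andbF.
    - by move=> t tx; rewrite /e1 bump2_out// in_itv/= [X in _ && X]ltNge (le_trans h1 tx) andbF.
  have sub : closure [set x | phi x != 0] `<=` `[lo, hi].
    have /closure_id -> := @itv_closed _ R lo hi.
    apply: closureS.
    move=> x /= px; rewrite in_itv/=; apply/andP; split; rewrite leNgt; apply: contra px => /ltW hx.
      by rewrite phi_lo.
    by rewrite phi_hi.
  have test : test_function 0 b phi.
    split.
    - apply: Ck_smooth => -[|m]; first by exists dphi.
      exists dphi => //; apply: CkD; apply: CkM; (try exact: Ck_cst); exact: Ck_bump2.
    - by apply: subclosed_compact sub; [exact: closed_closure|exact: segment_compact].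
    - apply: (subset_trans sub) => x; rewrite /= !in_itv/= => /andP[h1 h2].
      by rewrite (lt_le_trans _ h1) ?(le_lt_trans h2)// ?gt_max ?beb// lt_min al0.
  have := weak phi test; rewrite dphiE.
  have out x : x \notin `]0, b[ -> e1 x = 0 /\ e2 x = 0.
    rewrite in_itv/= => /negP xb; split; apply: bump2_out; apply/negP; rewrite in_itv/= => /andP[h1 h2]; apply: xb.
      by rewrite (lt_trans al0)//= (lt_trans h2).
    by rewrite (lt_trans ga0)//= (lt_trans h2).
  have -> : \int[mu]_(x in `]0, b[) (f x * dphi x) = \int[mu]_x (f1 x * dphi x).
    rewrite Rintegral_mkcond; apply: eq_Rintegral => x _.
    by rewrite /f1 !patchE; case: ifP => // _; rewrite mul0r.
  have -> : \int[mu]_(x in `]0, b[) (h0 x * phi x) = \int[mu]_x (h x * phi x).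
    rewrite Rintegral_mkcond; apply: eq_Rintegral => x _.
    by rewrite /h !patchE; case: ifP => // _; rewrite mul0r.

  have iMb (q r : R -> R) (C : R) : mu.-integrable setT (EFin \o q) -> measurable_fun setT r ->
      (forall x, `|r x| <= C) -> mu.-integrable setT (EFin \o (fun x => q x * r x)).
    move=> iq mr rC; apply: (@L1_le _ _ (fun x => C * `|q x|)).
    - by apply: measurable_funM => //; exact: L1_measurable iq.
    - by move=> x; rewrite normrM mulrC ler_wpM2r.
    - by have := integrableZl measurableT C (integrable_norm iq).
  have lin (q r1 r2 : R -> R) (c1 c2 : R) : mu.-integrable setT (EFin \o (fun x => q x * r1 x)) ->
      mu.-integrable setT (EFin \o (fun x => q x * r2 x)) ->
      \int[mu]_x (q x * (c1 * r1 x + c2 * r2 x)) =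
      c1 * \int[mu]_x (q x * r1 x) + c2 * \int[mu]_x (q x * r2 x).
    move=> i1 i2; rewrite -!RintegralZl// -RintegralD//.
    - by apply: eq_Rintegral => x _; ring.
    - by have := integrableZl measurableT c1 i1.
    - by have := integrableZl measurableT c2 i2.
  have mP (e : R -> R) : mu.-integrable setT (EFin \o e) ->
      mu.-integrable setT (EFin \o (fun x => h x * primitive e x)).
    move=> ie; apply: (iMb _ _ (\int[mu]_t `|e t|)) => //; first exact: measurable_primitive.
    by move=> x; exact: primitive_norm_le.
  have parts (e : R -> R) : mu.-integrable setT (EFin \o e) ->
      \int[mu]_x (primitive h x * e x) =
      (\int[mu]_t e t) * (\int[mu]_x h x) - \int[mu]_x (h x * primitive e x).
    move=> ie; rewrite primitive_parts// -RintegralZl// -RintegralB//.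
    - by apply: eq_Rintegral => x _; ring.
    - by have := integrableZl measurableT (\int[mu]_t e t) ih.
    - exact: mP.
  have ipe (e : R -> R) : mu.-integrable setT (EFin \o e) ->
      mu.-integrable setT (EFin \o (fun x => primitive h x * e x)).
    move=> ie; have := iMb e (primitive h) (\int[mu]_t `|h t|) ie mph (fun x => primitive_norm_le x ih).
    by apply: eq_integrable => // x _ /=; rewrite mulrC.
  have pe (e : R -> R) : mu.-integrable setT (EFin \o e) ->
      mu.-integrable setT (EFin \o (fun x => f1 x * e x)) -> (forall x, x \notin `]0, b[ -> e x = 0) ->
      \int[mu]_x (p x * e x) = \int[mu]_x (f1 x * e x) - \int[mu]_x (primitive h x * e x).
    move=> ie ife eout; rewrite -RintegralB//; last exact: ipe.
    apply: eq_Rintegral => x _; rewrite pE indicE mem_setE.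
    by have [xD|/eout ->] := boolP (x \in `]0, b[); rewrite ?mulr0 ?subrr// mul1r mulrBl.
  have i1 := ib al be n; have i2 := ib ga de n.
  have L1 := lin f1 e1 e2 B (- A) (iM f1 al be n if1) (iM f1 ga de n if1).
  have L2 := lin h (primitive e1) (primitive e2) B (- A) (mP e1 i1) (mP e2 i2).
  have E1 := pe e1 i1 (iM f1 al be n if1) (fun x xo => (out x xo).1).
  have E2 := pe e2 i2 (iM f1 ga de n if1) (fun x xo => (out x xo).2).
  rewrite /dphi /phi L1 L2 E1 E2 (parts e1 i1) (parts e2 i2) -/A -/B.
  set X1 := \int[mu]_x (f1 x * e1 x); set X2 := \int[mu]_x (f1 x * e2 x).
  set Y1 := \int[mu]_x (h x * primitive e1 x); set Y2 := \int[mu]_x (h x * primitive e2 x).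
  set H := \int[mu]_x h x => w.
  apply/eqP; rewrite -subr_eq0; apply/eqP.
  transitivity ((B * X1 + - A * X2) + (B * Y1 + - A * Y2)); first by ring.
  by rewrite w addNr.
have i1 : mu.-integrable setT (EFin \o (\1_`]0, b[ : R -> R)) by exact: integrable_indic_itv.
(* As the bump parameter 1/(n+1) tends to 0, the integrals of the bumps tend to the lengths of the
   intervals, and the weighted integrals of p to its integrals over them. *)
have mean (al be ga de : R) : 0 < al -> al < be -> be < b -> 0 < ga -> ga < de -> de < b ->
    (de - ga) * \int[mu]_(x in `]al, be[) p x = (be - al) * \int[mu]_(x in `]ga, de[) p x.
  move=> al0 albe beb ga0 gade deb.
  have len (x y : R) : 0 < x -> x < y -> y < b ->
      \int[mu]_t bump2 n.+1%:R^-1 x y t @[n --> \oo] --> y - x.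
    move=> x0 xy yb; have := @bump2_cvg (\1_`]0, b[) x y i1.
    rewrite [X in _ --> X](_ : _ = y - x).
      rewrite (_ : (fun n => _) = (fun n => \int[mu]_t bump2 n.+1%:R^-1 x y t))//.
      apply/funext => n; apply: eq_Rintegral => t _; rewrite indicE mem_setE.
      have [tD|tD] := boolP (t \in `]0, b[); first by rewrite mul1r.
      rewrite bump2_out ?mulr0//; apply: contra tD; rewrite !in_itv/= => /andP[xt ty].
      by rewrite (lt_trans x0)//= (lt_trans ty).
    apply: (@etrans _ _ (\int[mu]_(t in `]x, y[) (1 : R))).
      apply: eq_Rintegral => t; rewrite inE/= in_itv/= => /andP[xt ty]; rewrite indicE mem_set//= in_itv/=.
      by rewrite (lt_trans x0)//= (lt_trans ty).
    by rewrite Rintegral_cst// mul1r; apply: (etrans (f_equal fine (lebesgue_measure_itv `]x, y[))); rewrite /= lte_fin xy.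
  have c1 : (\int[mu]_x bump2 n.+1%:R^-1 ga de x) * \int[mu]_x (p x * bump2 n.+1%:R^-1 al be x)
      @[n --> \oo] --> (de - ga) * \int[mu]_(x in `]al, be[) p x.
    by apply: cvgM; [exact: len|exact: bump2_cvg].
  have c2 : (\int[mu]_x bump2 n.+1%:R^-1 al be x) * \int[mu]_x (p x * bump2 n.+1%:R^-1 ga de x)
      @[n --> \oo] --> (be - al) * \int[mu]_(x in `]ga, de[) p x.
    by apply: cvgM; [exact: len|exact: bump2_cvg].
  exact: (seq_cvg_eq (fun n => ortho n al be ga de al0 albe beb ga0 gade deb) c1 c2).
(* The mean of p over the middle third, a reference interval whose end points are interior as test
   functions require. *)
pose m := \int[mu]_(x in `](b / 3), (2 * b / 3)[) p x / (b / 3).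
exists m, h; split => //.
  by move=> t t0; rewrite /h patchE mem_setE in_itv/= ltNge t0.
apply: aeW (primitive_derive ip) _ => x [dp pd] xD.
have inc y z : 0 < y -> y < z -> z < b -> primitive p z - primitive p y = m * (z - y).
  move=> y0 yz zb; rewrite primitiveB//; last exact: ltW.
  have h1 : 0 < b / 3 by lra.
  have h2 : b / 3 < 2 * b / 3 by lra.
  have h3 : 2 * b / 3 < b by lra.
  have e := mean y z (b / 3) (2 * b / 3) y0 yz zb h1 h2 h3.
  have b30 : b / 3 != 0 by rewrite gt_eqF// divr_gt0.
  apply: (mulfI b30); rewrite (_ : b / 3 = 2 * b / 3 - b / 3); last by lra.
  rewrite e /m (_ : 2 * b / 3 - b / 3 = b / 3); last by lra.
  by field; rewrite gt_eqF.
have pxm : p x = m.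
  rewrite -pd derive1E.
  have d1 : is_derive x 1 (fun z : R => m *: z + (primitive p x - m * x)) (m *: 1 + 0) by exact: is_deriveD.
  rewrite (@near_eq_derive R R R _ (fun z : R => m *: z + (primitive p x - m * x))).
    by have [_ ->] := d1; rewrite addr0 /GRing.scale/= mulr1.
  near=> z; rewrite /GRing.scale/=.
  have : z \in `]0, b[ by near: z; exact: near_in_itvoo.
  have := xD; rewrite !in_itv/= => /andP[x0 xb] /andP[z0 zb].
  have [zx|xz|->] := ltgtP z x; last by ring.
    by have := inc z x z0 zx xb; move=> h'; apply/eqP; rewrite -subr_eq0; apply/eqP; move: h'; lra.
  by have := inc x z x0 xz zb; move=> h'; apply/eqP; rewrite -subr_eq0; apply/eqP; move: h'; lra.
by rewrite -pxm /p xD subrK /f1 patchE mem_setE xD.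
Unshelve. all: by end_near. Qed.

End w11.

(** * Extraction of the kernels *)

Import HBSimple HBNNSimple.

(** * Integrals off null sets and Borel versions of derivatives *)

Section nulls.
Context {R : realType}.
Notation mu := (@lebesgue_measure R).

(** Measurability of [f] and [g] is not assumed, since s -> w(s,t) is known to agree with a Borel
    function only off a null set. The integral is a supremum over simple minorants, and a minorant
    of [f] set to zero on [N] is a minorant of [g] with the same integral. *)
Lemma ge0_integral_le_off_null (N : set R) (f g : R -> \bar R) : measurable N -> mu N = 0%E ->
  (forall x, 0 <= f x)%E -> (forall x, 0 <= g x)%E -> (forall x, ~ N x -> f x = g x) ->
  (\int[mu]_x f x <= \int[mu]_x g x)%E.
Proof.
move=> mN N0 f0 g0 fg; rewrite !ge0_integralTE//.
apply: ub_ereal_sup => _ [h /= hf <-].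
have mC : measurable (~` N) by exact: measurableC.
pose h' : {nnsfun measurableTypeR R >-> R} := mul_nnsfun h (@indic_nnsfun _ (measurableTypeR R) R (~` N) mC).
have h'E x : h' x = h x * \1_(~` N) x by [].
apply: ereal_sup_ge; exists (sintegral mu h').
  exists h' => // x; rewrite h'E indicE; have [Nx|nNx] := pselect (N x).
    by rewrite memNset ?mulr0//= => nN; apply: nN.
  by rewrite mem_set// mulr1 -fg.
rewrite -!integralT_nnsfun; rewrite le_eqVlt; apply/orP; left; apply/eqP.
have mh (l : {nnsfun measurableTypeR R >-> R}) : measurable_fun setT (fun x : R => (l x)%:E).
  by apply/measurable_EFinP; have := @measurable_funPT _ _ _ _ l.
apply: (ae_eq_int (mh h) (mh h')).
exists N; split => // x /=; apply: contra_notP => nNx.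
by rewrite /mindic indicE mem_set// mulr1.
Qed.

Lemma Rintegral_eq_off_null (N D : set R) (f g : R -> R) : measurable N -> mu N = 0%E ->
  (forall x, D x -> ~ N x -> f x = g x) -> \int[mu]_(x in D) f x = \int[mu]_(x in D) g x.
Proof.
move=> mN N0 fg; rewrite [LHS]Rintegral_mkcond [RHS]Rintegral_mkcond.
have {}fg x : ~ N x -> (f \_ D) x = (g \_ D) x.
  by move=> Nx; rewrite !patchE; case: ifPn => //; rewrite inE => Dx; exact: fg.
congr fine; rewrite integralE [RHS]integralE; congr (_ - _)%E; apply/eqP; rewrite eq_le;
  apply/andP; split; apply: (ge0_integral_le_off_null mN N0) => // x Nx;
  by rewrite ?funeposE ?funenegE /= fg.
Qed.

(** The upper limit of forward difference quotients with step 1/(n+1) depends measurably on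
    parameters, unlike the bare derivative. Only values at t and to its right enter. *)
Lemma derive1_limn_esup (F G : R -> R) (t d : R) : derivable F t 1 -> 0 < d ->
  (forall y, t <= y -> y < t + d -> G y = F y) ->
  fine (limn_esup (fun n : nat => (n.+1%:R * (G (t + n.+1%:R^-1) - G t))%:E)) = derive1 F t.
Proof.
move=> dF d0 GF.
have cF : (fun h => h^-1 *: (F (h *: 1 + t) - F t)) @ 0^' --> derive1 F t.
  by rewrite derive1E; exact: dF.
suff h : (n.+1%:R * (G (t + n.+1%:R^-1) - G t))%:E @[n --> \oo] --> (derive1 F t)%:E.
  by rewrite is_cvg_limn_esupE ?(cvg_lim _ h)//; apply/cvg_ex; exists (derive1 F t)%:E.
apply: cvg_EFin; first by near=> n.
have sq : (n.+1%:R^-1 : R) @[n --> \oo] --> 0^'.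
  move=> A [r /= r0 hA]; suff : \forall n \near \oo, A (n.+1%:R^-1 : R) by [].
  near=> n; apply: hA.
    rewrite /= sub0r normrN gtr0_norm//; near: n; exact: (near_infty_natSinv_lt (PosNum r0)).
  by rewrite invr_eq0.
have := @cvg_comp _ _ _ (fun n : nat => n.+1%:R^-1 : R) _ _ _ _ sq cF; apply: cvg_trans; apply: near_eq_cvg; near=> n => /=.
rewrite invrK /GRing.scale/= mulr1 (addrC _ t) !GF ?ltrD2l ?lexx ?ltrDl ?lerDl//.
by near: n; exact: (near_infty_natSinv_lt (PosNum d0)).
Unshelve. all: by end_near.
Qed.

(** [H] is the upper limit of the difference quotients of [qt], replaced by 0 where it exceeds
    [gam]: it is thus Borel and dominated everywhere. On a section where [qt] coincides with [F] it
    equals the derivative almost everywhere, and the fundamental theorem applies. *)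
Lemma derivative_kernel (gam : R -> R) (qt : R * R -> R) : measurable_fun setT qt ->
  mu.-integrable setT (EFin \o gam) -> (forall t, 0 <= gam t) -> (forall t, t <= 0 -> gam t = 0) ->
  exists H, rel_kernel gam H /\ forall (s c : R) (F : R -> R),
    (forall t, 0 <= t -> t < c -> qt (s, t) = F t) -> abs_continuous 0 c F ->
    ae_on 0 c (fun t => derivable F t 1 /\ `|derive1 F t| <= gam t) ->
    forall t, 0 <= t -> t < c -> F t = F 0 + primitive (H s) t.
Proof.
move=> mq ig g0 gneg; have mg := L1_measurable ig.
pose L (p : R * R) := fine (limn_esup (fun n : nat => (n.+1%:R * (qt (p.1, p.2 + n.+1%:R^-1) - qt p))%:E)).
have mL : measurable_fun setT L.
  apply: measurableT_comp => //.
  apply: measurable_fun_limn_esup => n; apply/measurable_EFinP.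
  apply: measurable_funM => //; apply: measurable_funB => //.
  apply: (measurableT_comp mq (g := fun p : R * R => (p.1, p.2 + n.+1%:R^-1))).
  apply/measurable_fun_pair => //=; exact: measurable_funD.
pose H s t := if `|L (s, t)| <= gam t then L (s, t) else 0.
have mH : measurable_fun setT (fun p : R * R => H p.1 p.2).
  rewrite (_ : (fun p => _) = fun p : R * R => if `|L p| <= gam p.2 then L p else 0); last by apply/funext => -[].
  apply: measurable_fun_ifT => //; apply: measurable_fun_ler; first exact: measurableT_comp.
  exact: measurableT_comp.
have kH : rel_kernel gam H.
  by split => // s t; rewrite /H; case: ifP => // _; rewrite normr0.
exists H; split => // s c F qF acF aeF t t0 tc.
have iH : mu.-integrable setT (EFin \o H s).
  by apply: L1_le ig; [exact: (measurable_pair1 s mH)|case: kH].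
have := @abs_continuous_FTC _ 0 t F (H s) (abs_continuousW acF (lexx _) (ltW tc)) iH.
rewrite (@primitive_left _ (H s) 0 0)// => [|y y0]; last first.
  by apply/normr0_eq0/le_anti; rewrite normr_ge0 -(gneg _ y0) andbT; case: kH.
move=> -> //; rewrite ?subr0 ?t0 ?lexx//.
apply: aeW aeF _ => y hy; rewrite in_itv/= => /andP[y0 yt].
have yc := lt_trans yt tc.
have [|dF Fle] := hy; first by rewrite in_itv/= y0.
split => //; rewrite /H.
have -> : L (s, y) = derive1 F y.
  apply: (derive1_limn_esup (F := F) (G := fun t => qt (s, t)) (d := c - y)) => //=; first by rewrite subr_gt0.
  by move=> z yz; rewrite addrC subrK => zc; apply: qF => //; exact: le_trans (ltW y0) yz.
by rewrite Fle.
Qed.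

Lemma measurable_clamp (a b : R) (F : R -> R) : a <= b -> abs_continuous a b F ->
  measurable_fun setT (fun t : R => F (Num.max a (Num.min t b))).
Proof.
move=> ab acF; apply: continuous_measurable_fun => x.
have cl y : a <= Num.max a (Num.min y b) <= b.
  by rewrite le_max lexx ge_max ab ge_min lexx orbT.
have cc : continuous (fun t : R => Num.max a (Num.min t b)).
  move=> y; apply: (@continuous_max R R (fun=> a) (fun t => Num.min t b)); first exact: cvg_cst.
  by apply: (@continuous_min R R id (fun=> b)); [exact: cvg_id|exact: cvg_cst].
apply/cvgrPdist_lt => e e0; have [d d0 h] := abs_continuous_near acF (cl x) e0.
have /cvgrPdist_lt /(_ d d0) := cc x; apply: filterS => y yd.
by rewrite distrC; apply: h => //; rewrite distrC.
Qed.

(* The section at [0] is not exceptional because it can be redefined separately. *)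
Lemma borel_sections (b : R) (D : set (R * R)) (q : R -> R -> R) (lo hi : R -> R) :
  0 <= b -> measurable D -> measurable2_on D q -> lo 0 <= hi 0 ->
  (forall s t, 0 <= s -> s <= b -> lo s <= t -> t <= hi s -> D (s, t)) ->
  (forall s, s \in `[0, b] -> abs_continuous (lo s) (hi s) (q s)) ->
  exists Z : set R, [/\ measurable Z, mu Z = 0%E, ~ Z 0 &
    exists2 qt : R * R -> R, measurable_fun setT qt &
      forall s t, 0 <= s -> s <= b -> ~ Z s -> lo s <= t -> t < hi s -> qt (s, t) = q s t].
Proof.
move=> b0 mD mq lh hD ac; have [Z [mZ Z0 [qt [mqt hq]]]] := caratheodory_borel mD mq.
have s1 : measurable [set 0 : R] by [].
exists (Z `\ 0); split.
- exact: measurableD.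
- have sZ : Z `\ 0 `<=` Z by exact: subDsetl.
  by apply/eqP; rewrite eq_le measure_ge0 andbT -Z0; apply: le_measure; rewrite ?inE//; exact: measurableD.
- by case=> _; apply.
exists (fun p => if p.1 == 0 then q 0 (Num.max (lo 0) (Num.min p.2 (hi 0))) else qt p).
  apply: measurable_fun_ifT => //.
    apply: (measurable_fun_eqr (f := fst) (g := fun=> 0)) => //.
  have ac0 : abs_continuous (lo 0) (hi 0) (q 0) by apply: ac; rewrite in_itv/= lexx.
  exact: (measurableT_comp (measurable_clamp lh ac0) (g := snd)).
move=> s t s0 sb nZ lt_ th /=; case: eqVneq => [e|sn].
  by rewrite e in lt_ th *; rewrite min_l ?(ltW th)// max_r.
have sI : s \in `[0, b] by rewrite in_itv/= s0.
apply: hq.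
- by move=> Zs; apply: nZ; split => //; apply/eqP.
- exists (hi s - t); first by rewrite subr_gt0.
  move=> y ty; rewrite addrC subrK => yh; apply: hD => //; [exact: le_trans ty|exact: ltW].
move=> r r0; have [|d d0 hd] := abs_continuous_near (x := t) (ac _ sI) _ r0.
  by rewrite lt_ ltW.
exists (Num.min d (hi s - t)); first by rewrite lt_min d0 subr_gt0.
move=> y ty; rewrite -ltrBlDl lt_min => /andP[yd yh]; apply: hd.
  by rewrite (le_trans lt_ ty)/=; move: yh; rewrite ltrD2r => /ltW.
by rewrite ger0_norm// subr_ge0.
Qed.

End nulls.

(** * Borel kernels of the Sonine function and of the weight *)

Section extraction.
Context {R : realType}.
Notation mu := (@lebesgue_measure R).

Lemma triangle_measurable (b : R) : measurable [set p : R * R | 0 <= p.1 /\ 0 <= p.2 /\ p.1 + p.2 <= b].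
Proof.
rewrite (_ : mkset _ = (fun p : R * R => [&& 0 <= p.1, 0 <= p.2 & p.1 + p.2 <= b]) @^-1` [set true]); last first.
  by apply/seteqP; split => p /=; [move=> [-> [-> ->]]|move=> /and3P[]].
rewrite -[X in measurable X]setTI; apply: measurable_and => //; last first.
- by apply: measurable_and => //; apply: measurable_fun_ler => //; exact: measurable_funD.
- by apply: measurable_fun_ler.
Qed.

Lemma wedge_measurable (b : R) : measurable [set p : R * R | 0 <= p.1 /\ p.1 <= p.2 /\ p.2 <= b].
Proof.
rewrite (_ : mkset _ = (fun p : R * R => [&& 0 <= p.1, p.1 <= p.2 & p.2 <= b]) @^-1` [set true]); last first.
  by apply/seteqP; split => p /=; [move=> [-> [-> ->]]|move=> /and3P[]].
rewrite -[X in measurable X]setTI; apply: measurable_and => //; last first.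
- by apply: measurable_and => //; apply: measurable_fun_ler.
- by apply: measurable_fun_ler.
Qed.

Lemma sonine_kernel (b nu1 nu2 : R) (g : R -> R -> R) (gbar : R -> R) : 0 < b ->
  measurable2_on [set p | 0 <= p.1 /\ 0 <= p.2 /\ p.1 + p.2 <= b] g ->
  (forall s, s \in `[0, b] -> abs_continuous 0 (b - s) (g s)) ->
  nu1 <= nu2 -> (forall s, s \in `[0, b] -> nu1 <= `|g s 0| <= nu2) -> 0 < nu1 ->
  L1 0 b gbar ->
  (forall s, s \in `[0, b] -> ae_on 0 (b - s) (fun t => derivable (g s) t 1 /\ `|d2 g s t| <= gbar t)) ->
  exists (Z : set R) (g0 gam : R -> R) (H : R -> R -> R), [/\ measurable Z, mu Z = 0%E, ~ Z 0 & [/\ measurable_fun setT g0,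
    (forall s, nu1 <= `|g0 s| <= nu2), rel_kernel gam H, (forall t, t <= 0 -> gam t = 0) &
    forall s, 0 <= s -> s < b -> ~ Z s -> forall t, 0 <= t -> t < b - s -> g s t = g0 s + primitive (H s) t]].
Proof.
move=> b0 mg acg nu12 gnu nu0 igbar dg.
have [|||Z [mZ Z0 nZ0 [gt mgt hgt]]] := borel_sections (lo := fun=> 0) (hi := fun s => b - s) (ltW b0) (triangle_measurable b) mg.
- by rewrite subr0 ltW.
- by move=> s t s0 sb t0 ts; split => //; split => //=; rewrite addrC -lerBrDr.
- exact: acg.
have mD : measurable (`]0, b[%classic : set R) by exact: measurable_itv.
pose gam t := `|(gbar \_ `]0, b[) t|.
have ig : mu.-integrable setT (EFin \o gam) by exact: integrable_norm (L1_restrict mD igbar).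
have gneg t : t <= 0 -> gam t = 0.
  by move=> t0; rewrite /gam patchE mem_setE in_itv/= ltNge t0/= normr0.
have gam0 t : 0 <= gam t by exact: normr_ge0.
have [H [kH hH]] := derivative_kernel mgt ig gam0 gneg.
(* The fallback value [nu1] keeps the two bounds valid at every s, including the exceptional ones,
   as division by [g0] requires. *)
pose g0 s := if nu1 <= `|gt (s, 0)| <= nu2 then gt (s, 0) else nu1.
exists Z, g0, gam, H; split => //; split => //.
- have m0 : measurable_fun setT (fun s => gt (s, 0)) := measurable_pair2 0 mgt.
  apply: measurable_fun_ifT => //; apply: measurable_and; apply: measurable_fun_ler => //; exact: measurableT_comp.
- by move=> s; rewrite /g0; case: ifP => // _; rewrite gtr0_norm// lexx.
move=> s s0 sb nZ t t0 tb.
have sI : s \in `[0, b] by rewrite in_itv/= s0 ltW.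
have -> : g0 s = g s 0.
  have e : gt (s, 0) = g s 0 by apply: hgt => //; [exact: ltW|rewrite subr_gt0].
  by rewrite /g0 e gnu.
apply: (hH s (b - s) (g s)) => //.
- by move=> y y0 yb; apply: hgt => //; exact: ltW.
- exact: acg.
apply: aeW (dg _ sI) _ => y hy yI; have [dF Fle] := hy yI; split => //.
rewrite /gam patchE mem_set; first by rewrite (le_trans Fle)// ler_norm.
by move: yI; rewrite /= !in_itv/= => /andP[-> yb]; rewrite (lt_le_trans yb)// lerBlDr lerDl.
Qed.

Lemma weight_kernel (b mu2 : R) (w : R -> R -> R) (wbar kk : R -> R) : 0 < b ->
  measurable2_on [set p | 0 <= p.1 /\ p.1 <= p.2 /\ p.2 <= b] w ->
  (forall s, s \in `[0, b] -> abs_continuous s b (w s)) ->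
  (forall s, s \in `[0, b] -> `|w s s| <= mu2) -> L1 0 b wbar ->
  (forall s, s \in `[0, b] -> ae_on s b (fun t => derivable (w s) t 1 /\ `|d2 w s t| <= wbar (t - s))) ->
  mu.-integrable setT (EFin \o kk) ->
  exists (Z : set R) (M : R) (A : R -> R -> R), [/\ measurable Z, mu Z = 0%E, ~ Z 0, rel_kernel (fun t => M * `|kk t|) A &
    forall s, 0 <= s -> s < b -> ~ Z s -> forall z, 0 <= z -> z < b - s -> A s z = w s (s + z) * kk z].
Proof.
move=> b0 mw acw wmu iwbar dw ik; have mk := L1_measurable ik.
have [|||Z [mZ Z0 nZ0 [wt mwt hwt]]] := borel_sections (lo := id) (hi := fun=> b) (ltW b0) (wedge_measurable b) mw.
- exact: ltW.
- by move=> s t s0 sb t0 ts; split.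
- exact: acw.
have mD : measurable (`]0, b[%classic : set R) by exact: measurable_itv.
pose wb t := `|(wbar \_ `]0, b[) t|.
have iw : mu.-integrable setT (EFin \o wb) by exact: integrable_norm (L1_restrict mD iwbar).
(* The diagonal value of w is at most [mu2], and the variation of w(s,.) from the diagonal is at
   most the integral of [wb]. So w is bounded, and w(s,s+z)k(z) is dominated by a multiple of
   |k(z)|. *)
pose M := mu2 + \int[mu]_t wb t.
have wM s t : 0 <= s -> s <= t -> t <= b -> `|w s t| <= M.
  move=> s0 st tb; have sI : s \in `[0, b] by rewrite in_itv/= s0 (le_trans st).
  have ish : mu.-integrable setT (EFin \o (fun t => wb (t + - s))) by exact: integrable_translation.
  have h := abs_continuous_diff_le (abs_continuousW (acw s sI) (lexx _) tb) st ish.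
  rewrite (_ : w s t = w s s + (w s t - w s s)); last by ring.
  apply: (le_trans (ler_normD _ _)); apply: lerD; first exact: wmu.
  apply: (le_trans (h _)).
    apply: aeW (dw _ sI) _ => y hy; rewrite in_itv/= => /andP[sy yt].
    have yb := lt_le_trans yt tb.
    have [|dF Fle] := hy; first by rewrite in_itv/= sy.
    split => //; rewrite /wb patchE mem_set; first by rewrite (le_trans Fle)// ler_norm.
    by rewrite /= in_itv/= subr_gt0 sy ltrBlDr (lt_le_trans yb)// lerDl.
  have p0 : 0 <= primitive (fun t => wb (t + - s)) s by apply/fine_ge0/integral_ge0 => y _; rewrite lee_fin; exact: normr_ge0.
  apply: (@le_trans _ _ (primitive (fun t => wb (t + - s)) t)); first by rewrite gerBl.
  apply: (le_trans (ler_norm _)); apply: (le_trans (primitive_norm_le _ ish)).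
  rewrite le_eqVlt; apply/orP; left; apply/eqP.
  rewrite /Rintegral; congr fine.
  apply: (etrans (@eq_int _ _ (fun y => (wb (y - s))%:E) _)).
    by move=> y; rewrite /= /wb normr_id.
  apply: (@integral_translation R (- s) (fun y => (wb y)%:E)).
  by apply/measurable_EFinP; exact: L1_measurable iw.
have M0 : 0 <= M by apply: le_trans (wM 0 0 _ _ _) => //; exact: ltW.
pose W s z := if `|wt (s, s + z)| <= M then wt (s, s + z) else 0.
have mW : measurable_fun setT (fun p : R * R => W p.1 p.2).
  have m0 : measurable_fun setT (fun p : R * R => wt (p.1, p.1 + p.2)).
    apply: (measurableT_comp mwt (g := fun p : R * R => (p.1, p.1 + p.2))).
    by apply/measurable_fun_pair => //=; exact: measurable_funD.
  apply: measurable_fun_ifT => //; apply: measurable_fun_ler => //; exact: measurableT_comp.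
exists Z, M, (fun s z => W s z * kk z); split => //.
- split.
  + by apply: measurable_funM => //; exact: measurableT_comp.
  + by have := integrableZl measurableT M (integrable_norm ik).
  + move=> s t; rewrite normrM ler_wpM2r// /W; case: ifP => // _.
    by rewrite normr0.
move=> s s0 sb nZ z z0 zb; congr (_ * _).
have st : s <= s + z by rewrite lerDl.
have sz : s + z < b by rewrite addrC -ltrBrDr.
have e : wt (s, s + z) = w s (s + z) by apply: hwt => //; exact: ltW.
by rewrite /W e wM//; exact: ltW.
Qed.
End extraction.

(** * The equation of the first kind *)

Section convolution.
Context {R : realType}.
Notation mu := (@lebesgue_measure R).
Implicit Types (f u v : R -> R) (A : R -> R -> R).

Lemma ae_neq (x : R) : {ae mu, forall s, s != x}.
Proof.
exists [set x]; split => //; first exact: lebesgue_measure_set1.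
by move=> s /= /negP; rewrite negbK => /eqP.
Qed.

Lemma rel_kernel_cst f : mu.-integrable setT (EFin \o f) ->
  rel_kernel (fun t => `|f t|) (fun _ => f).
Proof.
move=> fi; split => //; last exact: integrable_norm.
by apply: measurableT_comp => //; exact: L1_measurable.
Qed.

Lemma measurable_primitive2 (H : R -> R -> R) : measurable_fun setT (fun p : R * R => H p.1 p.2) ->
  measurable_fun setT (fun p : R * R => primitive (H p.1) p.2).
Proof.
move=> mH.
rewrite (_ : (fun p => _) = fun p : R * R => \int[mu]_y (if y <= p.2 then H p.1 y else 0)); last first.
  apply/funext => p; rewrite /primitive Rintegral_mkcond; apply: eq_Rintegral => y _.
  by rewrite patchE mem_setE in_itv.
apply: measurableT_comp => //.
apply: (measurable_integral2 (f := fun q : (R * R) * R => (if q.2 <= q.1.2 then H q.1.1 q.2 else 0)%:E)).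
apply/measurable_EFinP; apply: measurable_fun_ifT => //.
  by apply: measurable_fun_ler => //; exact: measurableT_comp.
apply: (measurableT_comp mH (g := fun q : (R * R) * R => (q.1.1, q.2))).
by apply/measurable_fun_pair => //=; exact: measurableT_comp.
Qed.

Lemma measurable_conv_kernel (K : R -> R) A : measurable_fun setT K ->
  measurable_fun setT (fun p : R * R => A p.1 p.2) ->
  measurable_fun setT (fun p : R * R => \int[mu]_z (K (p.2 - z) * A p.1 z)).
Proof.
move=> mK mA; apply: measurableT_comp => //.
apply: (measurable_integral2 (f := fun q : (R * R) * R => (K (q.1.2 - q.2) * A q.1.1 q.2)%:E)).
apply/measurable_EFinP; apply: measurable_funM.
  apply: (measurableT_comp mK); apply: measurable_funB => //; exact: measurableT_comp.
apply: (measurableT_comp mA (g := fun q : (R * R) * R => (q.1.1, q.2))).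
by apply/measurable_fun_pair => //=; exact: measurableT_comp.
Qed.

(** The kernel is known only for almost every t at almost every s. [ae_shear] converts this, for
    almost every x, into an identity for almost every s, after which [vop_primitive] applies. *)
Lemma vop_derivative (b C : R) gam H (g0 : R -> R) (P : R -> R -> R) u :
  rel_kernel gam H -> (forall t, t <= 0 -> gam t = 0) ->
  measurable_fun setT g0 -> (forall s, `|g0 s| <= C) ->
  measurable_fun setT (fun p : R * R => P p.1 p.2) -> (forall s t, t < 0 -> P s t = 0) ->
  mu.-integrable setT (EFin \o u) -> (forall x, x \notin `]0, b[ -> u x = 0) ->
  {ae mu, forall s, s \in `]0, b[ -> ae_on 0 (b - s) (fun t => P s t = g0 s + primitive (H s) t)} ->
  ae_on 0 b (fun x => vop P u x = primitive (fun y => g0 y * u y + vop H u y) x).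
Proof.
move=> kH gneg mg0 g0C mP Pneg iu u0 hP; have mu_ := L1_measurable iu.
have mH : measurable_fun setT (fun p : R * R => H p.1 p.2) by case: kH.
have Hneg s t : t <= 0 -> H s t = 0.
  by move=> t0; apply/normr0_eq0/le_anti; rewrite normr_ge0 -(gneg _ t0) andbT; case: kH.
have mpH := measurable_primitive2 mH.
pose f (p : R * R) := if [&& 0 < p.1, p.1 < b, 0 < p.2 & p.2 < b - p.1] then P p.1 p.2 - (g0 p.1 + primitive (H p.1) p.2) else 0.
have mf : measurable_fun setT f.
  apply: measurable_fun_ifT => //.
    apply: measurable_and; first exact: measurable_fun_ltr.
    apply: measurable_and; first exact: measurable_fun_ltr.
    apply: measurable_and; first exact: measurable_fun_ltr.
    by apply: measurable_fun_ltr => //; exact: measurable_funB.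
  by apply: measurable_funB => //; apply: measurable_funD => //; exact: measurableT_comp.
have f0 : {ae mu, forall s, {ae mu, forall t, f (s, t) = 0}}.
  apply: aeW hP _ => s hs; have [sI|sI] := boolP (s \in `]0, b[); last first.
    apply: aeW (ae_neq 0) _ => t _; rewrite /f/=; case: ifP => // /and4P[s0 sb _ _].
    by move: sI; rewrite in_itv/= s0 sb.
  apply: aeW (hs sI) _ => t ht; rewrite /f/=; case: ifP => // /and4P[_ _ t0 tb].
  by rewrite ht ?subrr// in_itv/= t0.
apply: aeW (ae_shear mf f0) _ => x hx; rewrite in_itv/= => /andP[x0 xb].
rewrite /primitive -(vop_primitive x kH iu mg0 g0C) /vop; congr fine.
have mL : measurable_fun setT (fun s : R => (P s (x - s) * u s)%:E).
  by apply/measurable_EFinP; exact: (measurable_pair1 x (measurable_vop_integrand mP mu_)).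
have mr : measurable_fun setT (fun s : R => (((s <= x)%R%:R * g0 s + primitive (H s) (x - s)) * u s)%:E).
  apply/measurable_EFinP; apply: measurable_funM => //; apply: measurable_funD.
    apply: measurable_funM => //.
    rewrite (_ : (fun s => _) = fun s : R => if s <= x then 1 else 0 : R); last first.
      by apply/funext => s; case: (s <= x).
    by apply: measurable_fun_ifT => //; exact: measurable_fun_ler.
  apply: (measurableT_comp mpH (g := fun s : R => (s, x - s))).
  by apply/measurable_fun_pair => //=; exact: measurable_funB.
apply: (ae_eq_int mL mr); apply: (aeW2 hx (ae_neq x)) => s fs sx.
have [sI|sI] := boolP (s \in `]0, b[); last by rewrite (u0 _ sI) !mulr0.
congr (_ * _)%:E; move: sI; rewrite in_itv/= => /andP[s0 sb].
case: (ltgtP s x) sx => // sx _.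
  rewrite mul1r; apply/eqP; rewrite -subr_eq0; apply/eqP; rewrite -fs /f/= s0 sb subr_gt0 sx.
  by rewrite ltrD2r xb.
rewrite Pneg ?subr_lt0// mul0r add0r (@primitive_left _ (H s) 0)//; first exact: Hneg.
by rewrite subr_le0 ltW.
Qed.

(** Causality: as [K] vanishes on the left, the convolution at x sees [phi] only on s < x < b, so
    its behaviour beyond [b] is immaterial. *)
Lemma conv_eq0 (b : R) (K phi : R -> R) (x : R) : measurable_fun setT K -> measurable_fun setT phi ->
  (forall t, t <= 0 -> K t = 0) -> (forall t, t <= 0 -> phi t = 0) ->
  ae_on 0 b (fun t => phi t = 0) -> x < b -> vop (fun _ => K) phi x = 0.
Proof.
move=> mK mphi K0 phi0 ephi xb; rewrite /vop /Rintegral.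
have mL : measurable_fun setT (fun s : R => (K (x - s) * phi s)%:E).
  apply/measurable_EFinP; apply: measurable_funM => //; apply: (measurableT_comp mK).
  exact: measurable_funB.
rewrite (@ae_eq_int _ _ (fun=> 0%E) mL) ?integral0//.
apply: aeW ephi _ => s hs.
have [xs|sx] := leP x s; first by rewrite K0 ?subr_le0// mul0r.
have [s0|s0] := leP s 0; first by rewrite phi0// mulr0.
by rewrite hs ?mulr0// in_itv/= s0 (lt_trans sx).
Qed.

Lemma primitive_eq (b : R) f1 f2 x : measurable_fun setT f1 -> measurable_fun setT f2 ->
  (forall t, t <= 0 -> f1 t = f2 t) -> ae_on 0 b (fun t => f1 t = f2 t) -> x < b ->
  primitive f1 x = primitive f2 x.
Proof.
move=> m1 m2 e0 e xb; rewrite /primitive [LHS]Rintegral_mkcond [RHS]Rintegral_mkcond.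
have mD : measurable (`]-oo, x]%classic : set R) by exact: measurable_itv.
have mr f : measurable_fun setT f -> measurable_fun setT (fun s => ((f \_ `]-oo, x]) s)%:E).
  by move=> mf; apply/measurable_EFinP/(measurable_restrictT _ mD); exact: measurable_funS mf.
congr fine; apply: (ae_eq_int (mr _ m1) (mr _ m2)); apply: aeW e _ => t ht.
rewrite !patchE mem_setE in_itv/=; case: ifP => // tx; have [t0|t0] := leP t 0; first by rewrite e0.
by rewrite ht// in_itv/= t0 (le_lt_trans tx).
Qed.

Lemma vop_left A u (x : R) : (forall s t, t <= 0 -> A s t = 0) -> (forall t, t <= 0 -> u t = 0) ->
  x <= 0 -> vop A u x = 0.
Proof.
move=> A0 u0 x0; rewrite /vop /Rintegral (@eq_int _ _ (fun=> 0%E)) ?integral0// => s.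
have [s0|s0] := leP s 0; first by rewrite u0// mulr0.
by rewrite A0 ?mul0r// subr_le0 (le_trans x0)// ltW.
Qed.

End convolution.

(** * Existence and uniqueness for an abstract Sonine pair *)

Section first_kind.
Context {R : realType}.
Notation mu := (@lebesgue_measure R).
Variables (b nu C : R) (K g0 gam alp : R -> R) (A H : R -> R -> R).
Hypotheses (iK : mu.-integrable setT (EFin \o K)) (K0 : forall t, t <= 0 -> K t = 0).
Hypotheses (kA : rel_kernel alp A) (alp0 : forall t, t <= 0 -> alp t = 0).
Hypotheses (nu0 : 0 < nu) (mg0 : measurable_fun setT g0) (g0nu : forall s, nu <= `|g0 s| <= C).
Hypotheses (kH : rel_kernel gam H) (gam0 : forall t, t <= 0 -> gam t = 0).
(** The relative kernel of [vop A] followed by convolution with [K]; for A(s,z) = w(s,s+z)k(z) it is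
    the left-hand side of the Sonine condition. *)
Let P s t := \int[mu]_z (K (t - z) * A s z).
Hypothesis hP : {ae mu, forall s, s \in `]0, b[ ->
  ae_on 0 (b - s) (fun t => P s t = g0 s + primitive (H s) t)}.
Hypothesis hP0 : ae_on 0 b (fun t => P 0 t = g0 0 + primitive (H 0) t).

Let g0C s : `|g0 s| <= C. Proof. by have /andP[] := g0nu s. Qed.
Let nug0 s : nu <= `|g0 s|. Proof. by have /andP[] := g0nu s. Qed.
Let mA : measurable_fun setT (fun p : R * R => A p.1 p.2). Proof. by case: kA. Qed.
Let A0 s t : t <= 0 -> A s t = 0.
Proof. by move=> t0; apply/normr0_eq0/le_anti; rewrite normr_ge0 -(alp0 t0) andbT; case: kA. Qed.
Let mK := L1_measurable iK.
Let mP : measurable_fun setT (fun p : R * R => P p.1 p.2) := measurable_conv_kernel mK mA.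
Let Pneg s t : t < 0 -> P s t = 0.
Proof.
move=> t0; rewrite /P /Rintegral (@eq_int _ _ (fun=> 0%E)) ?integral0// => z.
have [z0|z0] := leP z 0; first by rewrite A0// mulr0.
by rewrite K0 ?mul0r// subr_le0 ltW// (lt_trans t0).
Qed.

Let left0 (u : R -> R) : (forall x, x \notin `]0, b[ -> u x = 0) -> forall x, x <= 0 -> u x = 0.
Proof. by move=> u0 x x0; apply: u0; rewrite in_itv/= ltNge x0. Qed.

Let conv_vop (u : R -> R) : mu.-integrable setT (EFin \o u) -> (forall x, x \notin `]0, b[ -> u x = 0) ->
  ae_on 0 b (fun x => vop (fun _ => K) (vop A u) x = primitive (fun y => g0 y * u y + vop H u y) x).
Proof.
move=> iu u0; have h := vop_derivative kH gam0 mg0 g0C mP Pneg iu u0 hP.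
by apply: (aeW2 h (vop_assoc kA iK iu)) => x hx -> /hx.
Qed.

Let integrable_second_kind (c : R -> R) gm Hh (u : R -> R) : measurable_fun setT c -> (forall s, `|c s| <= C) ->
  rel_kernel gm Hh -> mu.-integrable setT (EFin \o u) ->
  mu.-integrable setT (EFin \o (fun y => c y * u y + vop Hh u y)).
Proof.
move=> mc cC kHh iu; have mu_ := L1_measurable iu.
have i1 : mu.-integrable setT (EFin \o (fun y => c y * u y)).
  apply: (L1_le (g := fun y => C * `|u y|)); first exact: measurable_funM.
    by move=> x; rewrite normrM ler_wpM2r.
  by have := integrableZl measurableT C (integrable_norm iu).
by have := integrableD measurableT i1 (vop_integrable kHh iu).
Qed.

Lemma first_kind_unique (u : R -> R) : mu.-integrable setT (EFin \o u) ->
  (forall x, x \notin `]0, b[ -> u x = 0) -> ae_on 0 b (fun x => vop A u x = 0) ->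
  {ae mu, forall x, u x = 0}.
Proof.
move=> iu u0 hu; apply: (volterra2_unique nu0 mg0 nug0 kH gam0 iu u0).
have iA := vop_integrable kA iu.
apply: (primitive_ae_inj (f2 := fun=> 0)) => //.
- exact: integrable_second_kind kH iu.
- exact: integrable0.
apply: aeW (conv_vop iu u0) _ => x hx xI; rewrite -hx//.
rewrite (conv_eq0 mK (L1_measurable iA) K0 _ hu).
- by rewrite /primitive /Rintegral integral0.
- by move=> t t0; apply: vop_left => //; exact: left0.
- by move: xI; rewrite in_itv/= => /andP[].
Qed.

(** Convolution with [A 0] commutes with that by [K], so the composed kernel is [P 0], the same for
    every s. Since [hP0] holds on all of []0, b[], the result is a second-kind equation with
    constant coefficient [g0 0] and kernel [H 0]. *)
Let sonine_injective (u : R -> R) : mu.-integrable setT (EFin \o u) ->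
  (forall x, x \notin `]0, b[ -> u x = 0) -> ae_on 0 b (fun x => vop (fun _ => K) u x = 0) ->
  {ae mu, forall x, u x = 0}.
Proof.
move=> iu u0 hu.
have kH0 : rel_kernel gam (fun _ => H 0).
  case: kH => mH ig Hle; split => //.
  exact: (measurableT_comp (measurable_pair1 0 mH) (g := snd)).
have iA0 : mu.-integrable setT (EFin \o A 0).
  by case: kA => _ ia Ale; apply: L1_le ia => //; exact: (measurable_pair1 0 mA).
have iKu := vop_integrable (rel_kernel_cst iK) iu.
have P0E t : \int[mu]_z (A 0 (t - z) * K z) = P 0 t.
  rewrite /P; congr fine.
  rewrite -(@integral_reflection R t (fun z => (K (t - z) * A 0 z)%:E)).
    by apply: eq_int => z; rewrite subKr mulrC.
  apply/measurable_EFinP; apply: measurable_funM; last exact: L1_measurable iA0.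
  by apply: (measurableT_comp mK); exact: measurable_funB.
apply: (@volterra2_unique _ b nu (fun=> g0 0) gam (fun _ => H 0)) => //.
apply: (primitive_ae_inj (f2 := fun=> 0)) => //.
- by apply: integrable_second_kind kH0 iu.
- exact: integrable0.
have h := @vop_derivative R b C gam (fun _ => H 0) (fun=> g0 0) (fun _ => P 0) u kH0 gam0
  (measurable_cst _) (fun _ => g0C 0) _ (fun _ => @Pneg 0) iu u0 _.
have {}h := h (measurableT_comp (measurable_pair1 0 mP) (measurable_snd)).
have {}h : ae_on 0 b (fun x => vop (fun _ => P 0) u x = primitive (fun y => g0 0 * u y + vop (fun _ => H 0) u y) x).
  apply: h; apply: aeW (ae_neq 0) _ => s _; rewrite in_itv/= => /andP[s0 sb].
  apply: aeW hP0 _ => t ht; rewrite in_itv/= => /andP[t0 tb]; apply: ht.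
  by rewrite in_itv/= t0 (lt_trans tb)// ltrBlDr ltrDl.
apply: (aeW2 h (vop_assoc (rel_kernel_cst iK) iA0 iu)) => x hx hc xI; rewrite -hx//.
rewrite (_ : (fun _ => P 0) = (fun _ t => \int[mu]_z (A 0 (t - z) * K z))); last first.
  by apply/funext => s; apply/funext => t; rewrite P0E.
rewrite -hc (conv_eq0 (L1_measurable iA0) (L1_measurable iKu) (@A0 0) _ hu).
- by rewrite /primitive /Rintegral integral0.
- by move=> t t0; apply: vop_left => //; exact: left0.
- by move: xI; rewrite in_itv/= => /andP[].
Qed.

(** After the reflection s -> x - s this is [vop_primitive] with [K] in the place of the unknown,
    jump c and kernel [h]. *)
Let conv_primitive (c : R) (h : R -> R) x : mu.-integrable setT (EFin \o h) -> (forall t, t <= 0 -> h t = 0) ->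
  x \in `]0, b[ ->
  vop (fun _ => K) ((fun t => c + primitive h t) \_ `]0, b[) x =
  primitive (fun y => c * K y + vop (fun _ => h) K y) x.
Proof.
move=> ih h0; rewrite in_itv/= => /andP[x0 xb]; have mh := L1_measurable ih.
have mD : measurable (`]0, b[%classic : set R) by exact: measurable_itv.
set phi := (_ \_ _).
have mphi : measurable_fun setT phi.
  apply/(measurable_restrictT _ mD); apply: measurable_funS measurableT (@subsetT _ _) _.
  by apply: measurable_funD => //; exact: measurable_primitive.
rewrite /primitive -(vop_primitive x (rel_kernel_cst ih) iK (measurable_cst c) (C := `|c|))//.
rewrite /vop; congr fine.
rewrite -(@integral_reflection R x (fun s => (K (x - s) * phi s)%:E)); last first.
  apply/measurable_EFinP; apply: measurable_funM => //.
  by apply: (measurableT_comp mK); exact: measurable_funB.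
have mL : measurable_fun setT (fun s : R => (K (x - (x - s)) * phi (x - s))%:E).
  apply/measurable_EFinP; apply: measurable_funM.
    by apply: (measurableT_comp mK); apply: measurable_funB => //; exact: measurable_funB.
  by apply: (measurableT_comp mphi); exact: measurable_funB.
have mr : measurable_fun setT (fun s : R => (((s <= x)%R%:R * c + primitive h (x - s)) * K s)%:E).
  apply/measurable_EFinP; apply: measurable_funM => //; apply: measurable_funD.
    apply: measurable_funM => //.
    rewrite (_ : (fun s => _) = fun s : R => if s <= x then 1 else 0 : R); last first.
      by apply/funext => s; case: (s <= x).
    by apply: measurable_fun_ifT => //; exact: measurable_fun_ler.
  by apply: (measurableT_comp (measurable_primitive ih)); exact: measurable_funB.
apply: (ae_eq_int mL mr); apply: aeW (ae_neq x) _ => s sx.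
rewrite subKr mulrC; congr (_%:E).
have [s0|s0] := leP s 0; first by rewrite K0// !mulr0.
congr (_ * _); rewrite /phi patchE mem_setE in_itv/= subr_gt0.
case: (ltgtP s x) sx => // sx _; last first.
  by rewrite mul0r add0r (primitive_left h0)// subr_le0 ltW.
by rewrite mul1r ltrBlDr (lt_trans xb)// ltrDl.
Qed.

Lemma first_kind_exists (c : R) (h : R -> R) : mu.-integrable setT (EFin \o h) ->
  (forall t, t <= 0 -> h t = 0) ->
  exists u, [/\ mu.-integrable setT (EFin \o u), (forall x, x \notin `]0, b[ -> u x = 0) &
    ae_on 0 b (fun x => vop A u x = c + primitive h x)].
Proof.
move=> ih h0; pose F y := c * K y + vop (fun _ => h) K y.
have mD : measurable (`]0, b[%classic : set R) by exact: measurable_itv.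
have iF : mu.-integrable setT (EFin \o F).
  have iK' := integrableZl measurableT c iK.
  by have := integrableD measurableT iK' (vop_integrable (rel_kernel_cst ih) iK).
have [u [iu u0 hu]] := volterra2_exists b nu0 mg0 nug0 kH gam0 iF.
exists u; split => //.
have iA := vop_integrable kA iu.
pose phi := (fun t => c + primitive h t) \_ `]0, b[.
have iphi : mu.-integrable setT (EFin \o phi).
  apply: (L1_le (g := fun t => (`|c| + \int[mu]_t `|h t|) * \1_(`]0, b[) t)).
  - apply/(measurable_restrictT _ mD); apply: measurable_funS measurableT (@subsetT _ _) _.
    by apply: measurable_funD => //; exact: measurable_primitive.
  - move=> x; rewrite /phi patchE indicE; case: ifP => _; last by rewrite normr0 mulr0.
    by rewrite mulr1; apply: (le_trans (ler_normD _ _)); rewrite lerD2l primitive_norm_le.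
  - by have := integrableZl measurableT (`|c| + \int[mu]_t `|h t|) (integrable_indic_itv 0 b false true).
(* The residual is cut off to []0, b[], since nothing is known of it beyond [b]; by causality the
   cut does not change its convolution with [K] before [b]. *)
pose d := (vop A u \- phi) \_ `]0, b[.
have id : mu.-integrable setT (EFin \o d).
  apply: L1_restrict => //; apply: (integrableS measurableT) => //.
  by have := integrableB measurableT iA iphi.
have d0 x : x \notin `]0, b[ -> d x = 0 by move=> xI; rewrite /d patchE mem_setE (negbTE xI).
suff e : {ae mu, forall x, d x = 0}.
  apply: aeW e _ => x + xI; rewrite /d patchE mem_setE xI /phi/= patchE mem_setE xI => /eqP.
  by rewrite subr_eq0 => /eqP.
apply: (sonine_injective id d0).
have kK := rel_kernel_cst iK.
have iB : mu.-integrable setT (EFin \o (vop A u \- phi)) by have := integrableB measurableT iA iphi.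
have iG := integrable_second_kind mg0 g0C kH iu.
have H0 s t : t <= 0 -> H s t = 0.
  by move=> t0; apply/normr0_eq0/le_anti; rewrite normr_ge0 -(gam0 t0) andbT; case: kH.
have eFu x : x < b -> primitive (fun y => g0 y * u y + vop H u y) x = primitive F x.
  apply: primitive_eq hu; [exact: L1_measurable iG|exact: L1_measurable iF|] => t t0.
  have u00 := left0 u0.
  by rewrite /F (vop_left H0 u00 t0) u00// K0// !mulr0 !add0r (vop_left _ K0 t0).
have eB x : x < b -> vop (fun _ => K) (d \- (vop A u \- phi)) x = 0.
  apply: conv_eq0 => //.
  - apply: measurable_funB; first exact: L1_measurable id.
    exact: L1_measurable iB.
  - move=> t t0 /=; rewrite (d0 t); last by rewrite in_itv/= ltNge t0.
    rewrite (vop_left A0 (left0 u0) t0) /phi patchE mem_setE in_itv/= ltNge t0/=.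
    by rewrite !subrr.
  - by apply: aeW (ae_neq 0) _ => t _ tI; rewrite /= /d patchE mem_setE tI subrr.
(* The convolutions of [K] with [vop A u] and with [phi] are both the primitive of [F], so that of
   [K] with [d] vanishes. *)
apply: (aeW2 (aeW2 (conv_vop iu u0) (vopB kK id iB) (fun _ a b => conj a b)) (vopB kK iA iphi)).
move=> x [h1 h2] h3 xI; have xb : x < b by move: xI; rewrite in_itv/= => /andP[].
move: h2; rewrite (eB _ xb) h3 h1// eFu// (conv_primitive c ih h0 xI) -/F subrr subr0.
by [].
Qed.

End first_kind.

(** The two integrands agree for s off [Z], a null set that does not depend on t; so the identity
    holds at every t, whether or not w(.,t) is Borel. *)
Lemma volterra_vop (R : realType) (b : R) (Z : set R) (w A : R -> R -> R) (k v v1 : R -> R) (t : R) :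
  measurable Z -> lebesgue_measure Z = 0%E ->
  (forall s z, z <= 0 -> A s z = 0) ->
  (forall s, 0 <= s -> s < b -> ~ Z s -> forall z, 0 < z -> z < b - s -> A s z = w s (s + z) * k z) ->
  (forall s, s \in `]0, b[ -> v1 s = v s) -> (forall s, s \notin `]0, b[ -> v1 s = 0) ->
  t \in `]0, b[ ->
  \int[@lebesgue_measure R]_(s in `]0, t[) (w s t * k (t - s) * v s) = vop A v1 t.
Proof.
move=> mZ Z0 A0 hA v1v v10; rewrite in_itv/= => /andP[t0 tb].
transitivity (\int[@lebesgue_measure R]_(s in `]0, t[) (A s (t - s) * v1 s)).
  apply: (Rintegral_eq_off_null mZ Z0) => s; rewrite /= in_itv/= => /andP[s0 st] nZ.
  have sb := lt_trans st tb.
  rewrite (hA s (ltW s0) sb nZ) ?subr_gt0// ?ltrD2r// (addrC s) subrK v1v// in_itv/= s0.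
  exact: sb.
rewrite Rintegral_mkcond /vop; apply: eq_Rintegral => s _.
rewrite patchE mem_setE in_itv/=; case: ifPn => // /nandP[|]; rewrite -leNgt => h.
  by rewrite v10 ?mulr0// in_itv/= ltNge h.
by rewrite A0 ?mul0r// subr_le0.
Qed.

Theorem theorem3p3 (R : realType) (b : R) (hb : 0 < b)
    (w : R -> R -> R) (hw : admissible_weight b w)
    (k K : R -> R) (g : R -> R -> R) (hk : WSC1 b w k K g)
    (f : R -> R) (hf : W11 0 b f)
    (Q sigma : R) (hQ : 0 < Q) (hsigma0 : 0 < sigma) (hsigma1 : sigma < 1)
    (hg : forall s : R, s \in `[0, b] ->
       ae_on 0 (b - s) (fun t => `|d2 g s t| <= Q * t `^ (- sigma))) :
  exists2 u : R -> R, volterra_solution b w k f u &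
    forall v : R -> R, volterra_solution b w k f v ->
      ae_on 0 b (fun t => v t = u t).
Proof.
have [mw acw [mu1 [mu2 [_ _ hmu]]] [wbar iwbar dw]] := hw.
have [[ik iK] hS [mg acg] [nu1 [nu2 [nu0 nu12 hnu]]] [gbar igbar dg]] := hk.
have mD : measurable (`]0, b[%classic : set R) by exact: measurable_itv.
have [c [h [ih h0 fE]]] := W11_primitive hb hf.
pose k1 := k \_ `]0, b[; pose K1 := K \_ `]0, b[.
have ik1 := L1_restrict mD ik; have iK1 := L1_restrict mD iK.
have left0 (q : R -> R) t : t <= 0 -> (q \_ `]0, b[) t = 0.
  by move=> t0; rewrite patchE mem_setE in_itv/= ltNge t0.
have in1 (q : R -> R) t : 0 < t -> t < b -> (q \_ `]0, b[) t = q t.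
  by move=> t0 tb; rewrite patchE mem_setE in_itv/= t0 tb.
have [Z1 [g0 [gam [H [mZ1 Z10 nZ1 [mg0 g0nu kH gam0 hH]]]]]] :=
  sonine_kernel hb mg acg nu12 hnu nu0 igbar dg.
have wmu s : s \in `[0, b] -> `|w s s| <= mu2 by move=> /hmu/andP[].
have [Z2 [M [A [mZ2 Z20 nZ2 kA hA]]]] := weight_kernel hb mw acw wmu iwbar dw ik1.
have alp0 t : t <= 0 -> M * `|k1 t| = 0 by move=> t0; rewrite /k1 left0// normr0 mulr0.
have A0 s t : t <= 0 -> A s t = 0.
  by move=> t0; apply/normr0_eq0/le_anti; rewrite normr_ge0 -(alp0 t t0) andbT; case: kA.
have hP s : 0 <= s -> s < b -> ~ Z1 s -> ~ Z2 s ->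
    ae_on 0 (b - s) (fun t => \int[@lebesgue_measure R]_z (K1 (t - z) * A s z) = g0 s + primitive (H s) t).
  move=> s0 sb n1 n2; have sI : s \in `[0, b] by rewrite in_itv/= s0 ltW.
  apply: aeW (hS s sI) _ => t ht tI; move: (tI); rewrite in_itv/= => /andP[t0 tb].
  rewrite -(hH s s0 sb n1 t (ltW t0) tb) -(ht tI) [RHS]Rintegral_mkcond.
  have tb' : t < b by rewrite (lt_le_trans tb)// gerBl.
  (* [A s z] vanishes for z <= 0 and K1(t - z) for z >= t, which reduces the integral over the line
     to the one over []0, t[]. *)
  apply: eq_Rintegral => z _; rewrite patchE mem_setE in_itv/=.
  have [z0|z0] := leP z 0; first by rewrite A0// mulr0.
  have [zt|tz] := ltP z t; last by rewrite /K1 left0 ?mul0r// subr_le0.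
  rewrite (hA s s0 sb n2 z (ltW z0) (lt_trans zt tb)) /K1 /k1 !in1 ?subr_gt0//.
  - by rewrite (addrC s); ring.
  - exact: lt_trans tb'.
  - by rewrite ltrBlDr (lt_trans tb')// ltrDl.
have aeP : {ae lebesgue_measure, forall s : R, s \in `]0, b[ ->
    ae_on 0 (b - s) (fun t => \int[@lebesgue_measure R]_z (K1 (t - z) * A s z) = g0 s + primitive (H s) t)}.
  have n1 : {ae lebesgue_measure, forall s : R, ~ Z1 s} by exists Z1; split => // s /= /contrapT.
  have n2 : {ae lebesgue_measure, forall s : R, ~ Z2 s} by exists Z2; split => // s /= /contrapT.
  apply: (aeW2 n1 n2) => s h1 h2; rewrite in_itv/= => /andP[s0 sb].
  by apply: hP => //; exact: ltW.
(* The slice s = 0 is available because neither exceptional set contains 0. *)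
have P0 := hP 0 (lexx _) hb nZ1 nZ2; rewrite subr0 in P0.
have vv := volterra_vop mZ2 Z20 A0 (w := w) (k := k) (b := b).
have hA' s : 0 <= s -> s < b -> ~ Z2 s -> forall z, 0 < z -> z < b - s -> A s z = w s (s + z) * k z.
  move=> s0 sb n2 z z0 zb; rewrite (hA s s0 sb n2 z (ltW z0) zb) /k1 in1//.
  by rewrite (lt_le_trans zb)// gerBl.
have [u [iu u0 hu]] := first_kind_exists iK1 (left0 K) kA alp0 nu0 mg0 g0nu kH gam0 aeP P0 c ih h0.
exists u.
  split; first exact: integrableS iu.
  apply: (aeW2 hu fE) => t h1 h2 tI; rewrite (h2 tI) -(h1 tI).
  exact: (vv u u t hA').
(* A competitor is integrable on []0, b[] only; extended by zero it enters the whole-line setting,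
   where its difference with u solves the homogeneous equation. *)
move=> v [iv hv]; pose v1 := v \_ `]0, b[.
have iv1 := L1_restrict mD iv.
have v10 x : x \notin `]0, b[ -> v1 x = 0 by move=> xI; rewrite /v1 patchE mem_setE (negbTE xI).
have id : lebesgue_measure.-integrable setT (EFin \o (v1 \- u)) by have := integrableB measurableT iv1 iu.
have e : {ae lebesgue_measure, forall x : R, (v1 \- u) x = 0}.
  apply: (first_kind_unique iK1 (left0 K) kA alp0 nu0 mg0 g0nu kH gam0 aeP id).
    by move=> x xI /=; rewrite v10// u0// subrr.
  apply: (aeW3 (aeW2 hu fE (fun _ p q => conj p q)) hv (vopB kA iv1 iu)) => t [h1 h2] h3 -> tI.
  rewrite (h1 tI) -(h2 tI) -(h3 tI) (vv v v1 t hA') ?subrr//.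
  by move=> s sI; rewrite /v1 patchE mem_setE sI.
apply: aeW e _ => x /= /eqP; rewrite subr_eq0 => /eqP + xI.
by rewrite /v1 patchE mem_setE xI.
Qed.
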